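(* The variety of complex $3$-dimensional metabelian commutative algebras has dimension $8$ and it has exactly $2$ irreducible components, namely $$\mathcal{C}_1=\overline{\mathcal{O}(\mathrm{M}_{07})}\quad\text{and}\quad \mathcal{C}_2=\overline{\mathcal{O}(\mathrm{M}_{04}^{\alpha})},$$ where $\mathrm{M}_{07}$ is the commutative algebra with $e_1e_3=e_1$, $e_2e_2=e_1$, and $\mathrm{M}_{04}^{\alpha}$ ($\alpha\in\mathbb{C}$) is the family of commutative algebras with $e_1e_3=e_1$, $e_2e_3=\alpha e_2$. In particular, there is exactly $1$ rigid algebra (up to isomorphism) in this variety.
   Context: Let $\mathbb{V}$ be a $3$-dimensional complex vector space with fixed basis $e_1,e_2,e_3$. Algebra structures on $\mathbb{V}$ (bilinear multiplications) are identified with points of the affine space $\mathrm{Hom}(\mathbb{V}\otimes\mathbb{V},\mathbb{V})\cong\mathbb{C}^{27}$ via structure constants. The variety of complex $3$-dimensional algebras of a class defined by polynomial identities is the Zariski-closed subset $\mathbb{L}$ of structures satisfying these identities (including the zero structure). Here the class is that of metabelian commutative algebras: commutative algebras satisfying $(xy)(zt)=0$. The group $\mathrm{GL}(\mathbb{V})$ acts on $\mathbb{L}$ by $(g*\mu)(x\otimes y)=g\mu(g^{-1}x\otimes g^{-1}y)$; $\mathcal{O}(\mathrm{A})$ is the orbit of a structure representing $\mathrm{A}$, and the bar is Zariski closure. For a parametrized family $\mathrm{A}^{\alpha}$, $\overline{\mathcal{O}(\mathrm{A}^{\alpha})}$ denotes the Zariski closure of the union of the orbits of all members of the family. An algebra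 is rigid in $\mathbb{L}$ if its orbit is an open subset of $\mathbb{L}$. In multiplication tables, products of basis elements that are zero or follow by commutativity are omitted. *)

(* Defs.v *)
From HB Require Import structures.
From mathcomp Require Import all_boot all_order all_algebra.
From mathcomp Require Import boolp classical_sets reals complex.
From mathcomp Require Import mpoly.

Set Implicit Arguments.
Unset Strict Implicit.
Unset Printing Implicit Defensive.

Import GRing.Theory.
Local Open Scope ring_scope.
Local Open Scope classical_set_scope.

Section Zariski.
Variables (K : fieldType) (I : finType).

Local Notation space := {ffun I -> K}.

(* The variables of the polynomial ring are numbered by [enum_val]. *)
Definition peval (x : space) (p : {mpoly K[#|I|]}) : K :=
  p.@[fun k => x (enum_val k)].

Definition zero_locus (S : set {mpoly K[#|I|]}) : set space :=
  [set x | forall p, S p -> peval x p = 0].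

Definition zclosed (F : set space) : Prop := exists S, F = zero_locus S.

Definition zopen (U : set space) : Prop := zclosed (~` U).

Definition zclosure (A : set space) : set space :=
  \bigcap_(F in [set F | zclosed F /\ A `<=` F]) F.

(* Closed and open subsets of X for the topology induced on X. *)
Definition zclosed_in (X Z : set space) : Prop :=
  exists F, zclosed F /\ Z = X `&` F.

Definition zopen_in (X Z : set space) : Prop :=
  exists U, zopen U /\ Z = X `&` U.

Definition zirreducible (Z : set space) : Prop :=
  Z !=set0 /\
  forall F G, zclosed F -> zclosed G -> Z `<=` F `|` G -> Z `<=` F \/ Z `<=` G.

Definition irr_component (X Z : set space) : Prop :=
  [/\ Z `<=` X, zirreducible Z &
      forall Z', Z' `<=` X -> zirreducible Z' -> Z `<=` Z' -> Z' = Z].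

(* Z 0 < Z 1 < ... < Z d; the values of Z beyond d are irrelevant. *)
Definition irr_chain (X : set space) (d : nat) (Z : nat -> set space) : Prop :=
  (forall i, (i <= d)%N -> zclosed_in X (Z i) /\ zirreducible (Z i)) /\
  (forall i, (i < d)%N -> Z i `<` Z i.+1).

(* Krull dimension of X with its induced topology. *)
Definition zdim (X : set space) (d : nat) : Prop :=
  (exists Z, irr_chain X d Z) /\
  (forall n Z, irr_chain X n Z -> (n <= d)%N).

End Zariski.

Section Algebras.
Variable K : fieldType.

Local Notation V := 'cV[K]_3.

(* [c (i, j, k)] is the coefficient of e_k in the product e_i e_j. *)
Definition structure3 : Type := {ffun 'I_3 * 'I_3 * 'I_3 -> K}.

Definition e_ (i : 'I_3) : V := delta_mx i 0.

Definition alg_mul (c : structure3) (x y : V) : V :=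
  \col_k \sum_i \sum_j c (i, j, k) * x i 0 * y j 0.

Definition of_table (t : 'I_3 -> 'I_3 -> V) : structure3 :=
  [ffun p => t p.1.1 p.1.2 p.2 0].

Definition metabelian_commutative : set structure3 :=
  [set c | (forall x y, alg_mul c x y = alg_mul c y x) /\
           (forall x y z t, alg_mul c (alg_mul c x y) (alg_mul c z t) = 0)].

Definition gact (g : 'M[K]_3) (c : structure3) : structure3 :=
  of_table (fun i j => g *m alg_mul c (invmx g *m e_ i) (invmx g *m e_ j)).

(* [gact g c] is g * c on all of V, not only on basis vectors. *)
Lemma mul_gact (g : 'M[K]_3) (c : structure3) (x y : V) :
  alg_mul (gact g c) x y = g *m alg_mul c (invmx g *m x) (invmx g *m y).
Proof.
have mul_suml (a : 'I_3 -> K) (u : 'I_3 -> V) w :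
    alg_mul c (\sum_i a i *: u i) w = \sum_i a i *: alg_mul c (u i) w.
  apply/colP => k; rewrite summxE mxE.
  under eq_bigr => i _ do under eq_bigr => j _ do
    rewrite summxE mulr_sumr mulr_suml.
  under eq_bigr => i _ do rewrite exchange_big /=.
  rewrite exchange_big /=; apply: eq_bigr => l _.
  rewrite !mxE mulr_sumr; apply: eq_bigr => i _.
  rewrite mulr_sumr; apply: eq_bigr => j _.
  by rewrite !mxE mulrCA !mulrA.
have mul_sumr (a : 'I_3 -> K) (u : 'I_3 -> V) w :
    alg_mul c w (\sum_i a i *: u i) = \sum_i a i *: alg_mul c w (u i).
  apply/colP => k; rewrite summxE mxE.
  under eq_bigr => i _ do under eq_bigr => j _ do rewrite summxE mulr_sumr.
  under eq_bigr => i _ do rewrite exchange_big /=.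
  rewrite exchange_big /=; apply: eq_bigr => l _.
  rewrite !mxE mulr_sumr; apply: eq_bigr => i _.
  rewrite mulr_sumr; apply: eq_bigr => j _.
  by rewrite !mxE mulrCA.
have decomp (h : 'M[K]_3) z : h *m z = \sum_i z i 0 *: (h *m e_ i).
  apply/colP => k; rewrite mxE summxE; apply: eq_bigr => i _.
  by rewrite mxE /e_ -colE mxE mulrC.
rewrite [invmx g *m x]decomp mul_suml mulmx_sumr; apply/colP => k.
rewrite summxE mxE; apply: eq_bigr => i _.
rewrite [invmx g *m y]decomp mul_sumr scaler_sumr mulmx_sumr summxE.
apply: eq_bigr => j _; rewrite -!scalemxAr ffunE /= [RHS]mxE [in RHS]mxE.
by rewrite -mulrA mulrC -mulrA.
Qed.

Definition GLorbit (c : structure3) : set structure3 :=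
  [set d | exists2 g, g \in unitmx & d = gact g c].

Definition alg_isomorphic (c d : structure3) : Prop :=
  exists2 g : 'M[K]_3, g \in unitmx &
    forall x y, g *m alg_mul c x y = alg_mul d (g *m x) (g *m y).

Definition rigid (L : set structure3) (c : structure3) : Prop :=
  L c /\ zopen_in L (GLorbit c).

(* In the two tables below the indices 0, 1, 2 stand for e_1, e_2, e_3. *)
Definition M07 : structure3 :=
  of_table (fun i j => match val i, val j with
    | 0, 2 | 2, 0 => e_ 0
    | 1, 1 => e_ 0
    | _, _ => 0
    end).

Definition M04 (alpha : K) : structure3 :=
  of_table (fun i j => match val i, val j with
    | 0, 2 | 2, 0 => e_ 0
    | 1, 2 | 2, 1 => alpha *: e_ 1
    | _, _ => 0
    end).

End Algebras.

Arguments M07 {K}.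
Arguments metabelian_commutative : clear implicits.

(* Main.v *)
Require Import Defs.
From mathcomp Require Import all_boot all_order all_algebra.
From mathcomp Require Import boolp classical_sets reals complex.
From mathcomp Require Import perm mpoly ring zify.

(** The product of a metabelian commutative algebra is either x * y = B(x, y) w
with B symmetric and B(w, w) = 0, or x * y = l(x) S(y) + l(y) S(x) with l S = 0,
according to whether the algebra square has dimension at most 1 or equal to 2.
In the first case either B is nondegenerate and the algebra is isomorphic to M07,
or B is a product of two linear forms and the algebra is also of the second kind.
Perturbing S shows that the algebras of the second kind are limits of the M04^a,
and det (c(., ., k)) = 0 separates them from M07; hence the variety is the disjoint
union of the orbit of M07 and of C2. Irreducibility of C1 and C2 follows from the
polynomial parametrization of orbits by GL_3, using that two points joined by a
polynomial curve cannot be separated. No orbit other than that of M07 is open,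
because an open orbit meeting the line of the M04^a would contain almost all of it.

Dimension: if f_i vanishes on Z_i but not on Z_{i+1} in a chain of irreducible
sets, the monomials in f_0, ..., f_{n-1} are linearly independent on Z_n. The
variety is covered by images of polynomial maps from K^8, and counting monomials
of bounded degree gives n <= 8. A flag of coordinate subspaces of K^8 gives a
chain of length 8. *)

Set Implicit Arguments.
Unset Strict Implicit.
Unset Printing Implicit Defensive.

Import Order.TTheory GRing.Theory Num.Theory.
Local Open Scope ring_scope.
Local Open Scope complex_scope.
Local Open Scope classical_set_scope.

(** * Polynomial functions and the Zariski topology *)

Section FunctionAlgebras.
Variables (T : Type) (K : fieldType).

(** Covers polynomial functions on affine space and in one variable alike, so that determinants,
    adjugates and substitutions are treated once. *)
Record is_subalg (A : (T -> K) -> Prop) : Prop := IsSubalg {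
  subalg_cst : forall a, A (fun=> a);
  subalgD : forall f g, A f -> A g -> A (fun x => f x + g x);
  subalgM : forall f g, A f -> A g -> A (fun x => f x * g x) }.

Variables (A : (T -> K) -> Prop) (subA : is_subalg A).

Lemma subalg_sum (J : Type) (r : seq J) (P : pred J) (f : J -> T -> K) :
  (forall j, A (f j)) -> A (fun x => \sum_(j <- r | P j) f j x).
Proof.
move=> Af; elim: r => [|j r IHr].
  under eq_fun do rewrite big_nil; exact: (subalg_cst subA).
under eq_fun do rewrite big_cons.
by case: (P j) => //; apply: (subalgD subA).
Qed.

Lemma subalg_prod (J : Type) (r : seq J) (P : pred J) (f : J -> T -> K) :
  (forall j, A (f j)) -> A (fun x => \prod_(j <- r | P j) f j x).
Proof.
move=> Af; elim: r => [|j r IHr].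
  under eq_fun do rewrite big_nil; exact: (subalg_cst subA).
under eq_fun do rewrite big_cons.
by case: (P j) => //; apply: (subalgM subA).
Qed.

Lemma subalgX n f : A f -> A (fun x => f x ^+ n).
Proof.
move=> Af; elim: n => [|n IHn]; first exact: (subalg_cst subA).
under eq_fun do rewrite exprS; exact: (subalgM subA).
Qed.

Lemma subalgN f : A f -> A (fun x => - f x).
Proof.
move=> Af; under eq_fun do rewrite -mulN1r.
by apply: (subalgM subA) => //; apply: (subalg_cst subA).
Qed.

Lemma subalgB f g : A f -> A g -> A (fun x => f x - g x).
Proof. by move=> Af Ag; apply: (subalgD subA) => //; apply: subalgN. Qed.

Lemma subalg_det n (M : T -> 'M[K]_n) :
  (forall i j, A (fun x => M x i j)) -> A (fun x => \det (M x)).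
Proof.
move=> AM; rewrite /determinant; apply: (@subalg_sum _ _ _ (fun (s : 'S_n) x => (-1) ^+ s * \prod_i M x i (s i))) => s.
apply: (subalgM subA); first exact: (subalg_cst subA).
by apply: subalg_prod.
Qed.

Lemma subalg_adj n (M : T -> 'M[K]_n) :
  (forall i j, A (fun x => M x i j)) -> forall i j, A (fun x => (\adj (M x)) i j).
Proof.
move=> AM i j; under eq_fun do rewrite mxE.
apply: (subalgM subA); first exact: (subalg_cst subA).
by apply: subalg_det => k l; under eq_fun do rewrite !mxE.
Qed.

Lemma subalg_meval n (h : T -> 'I_n -> K) (p : {mpoly K[n]}) :
  (forall i, A (fun x => h x i)) -> A (fun x => p.@[h x]).
Proof.
move=> Ah; under eq_fun do rewrite mevalE.
apply: subalg_sum => m; apply: (subalgM subA); first exact: (subalg_cst subA).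
by apply: subalg_prod => i; apply: subalgX.
Qed.

End FunctionAlgebras.

Section PolynomialFunctions.
Variables (K : fieldType) (I : finType).
Local Notation space := {ffun I -> K}.

Definition polyfun (f : space -> K) := exists p, forall x, f x = peval x p.

Lemma polyfun_subalg : is_subalg polyfun.
Proof.
split=> [a|f g [p Hp] [q Hq]|f g [p Hp] [q Hq]].
- by exists a%:MP => x; rewrite /peval mevalC.
- by exists (p + q) => x; rewrite /peval mevalD Hp Hq.
- by exists (p * q) => x; rewrite /peval mevalM Hp Hq.
Qed.

Lemma polyfun_coord i : polyfun (fun x => x i).
Proof. by exists 'X_(enum_rank i) => x; rewrite /peval mevalXU enum_rankK. Qed.

Lemma subalg_peval (T : Type) (A : (T -> K) -> Prop) (g : T -> space) p :
  is_subalg A -> (forall i, A (fun x => g x i)) -> A (fun x => peval (g x) p).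
Proof. by move=> subA Ag; apply: subalg_meval. Qed.

Lemma zclosureP (A : set space) x :
  zclosure A x <->
  forall p, (forall y, A y -> peval y p = 0) -> peval x p = 0.
Proof.
split=> [Ax p Ap|Ax F [[S ->] AF] p Sp].
  pose F := zero_locus [set p]; suff Fx : F x by apply: Fx.
  apply: Ax; split=> [|y Ay q ->]; last exact: Ap.
  by exists [set p].
by apply: Ax => y Ay; apply: AF.
Qed.

Lemma zclosure_polyfun (A : set space) f : polyfun f ->
  (forall y, A y -> f y = 0) -> forall x, zclosure A x -> f x = 0.
Proof.
case=> p Hp Af x /zclosureP Ax; rewrite Hp; apply: Ax => y Ay.
by rewrite -Hp; apply: Af.
Qed.

Lemma subset_zclosure (A : set space) : A `<=` zclosure A.
Proof. by move=> x Ax; apply/zclosureP => p; apply. Qed.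

Lemma zclosed_zclosure (A : set space) : zclosed (zclosure A).
Proof.
exists [set p | forall y, A y -> peval y p = 0].
by apply/seteqP; split=> x /zclosureP.
Qed.

Lemma zclosure_min (A F : set space) :
  zclosed F -> A `<=` F -> zclosure A `<=` F.
Proof. by move=> cF AF x; apply. Qed.

Lemma zclosed_separate (F : set space) x : zclosed F -> ~ F x ->
  exists p, (forall y, F y -> peval y p = 0) /\ peval x p != 0.
Proof.
case=> S -> nFx; apply: contrapT => H; apply: nFx => p Sp.
apply/eqP; apply: contrapT => /negP px; apply: H; exists p; split=> // y.
by apply.
Qed.

Lemma zclosed_family (J : Type) (f : J -> space -> K) :
  (forall j, polyfun (f j)) -> zclosed [set x | forall j, f j x = 0].
Proof.
move=> /choice[p Hp]; exists (range p).
apply/seteqP; split=> x /= Hx.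
  by move=> _ [j _ <-]; rewrite -Hp.
by move=> j; rewrite Hp; apply: Hx; exists j.
Qed.

Lemma zirreducible_prod (Z : set space) f g :
  zirreducible Z -> polyfun f -> polyfun g ->
  (forall x, Z x -> f x * g x = 0) ->
  (forall x, Z x -> f x = 0) \/ (forall x, Z x -> g x = 0).
Proof.
case=> _ irrZ pf pg Hfg.
have [||x /Hfg /eqP||] := irrZ [set x | forall _ : unit, f x = 0]
  [set x | forall _ : unit, g x = 0].
- by apply: zclosed_family.
- by apply: zclosed_family.
- by rewrite mulf_eq0 => /orP[] /eqP fx0; [left|right].
- by move=> H; left=> x Zx; exact: (H x Zx tt).
- by move=> H; right=> x Zx; exact: (H x Zx tt).
Qed.

(** Two closed sets covering [Z], neither containing it, would give [p] and [q], each nonzero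
    somewhere on [Z], whose product vanishes on [Z]. *)
Lemma zirreducible_pevalI (Z : set space) : Z !=set0 ->
  (forall p q x y, Z x -> Z y -> peval x p != 0 -> peval y q != 0 ->
     exists2 z, Z z & peval z p * peval z q != 0) ->
  zirreducible Z.
Proof.
move=> Z0 H; split=> // F G cF cG ZFG.
apply: contrapT => /not_orP[/existsNP[x /not_implyP[Zx nFx]]].
move=> /existsNP[y /not_implyP[Zy nGy]].
have [p [Fp px]] := zclosed_separate cF nFx.
have [q [Gq qy]] := zclosed_separate cG nGy.
have [z Zz] := H p q x y Zx Zy px qy.
by case: (ZFG z Zz) => [/Fp->|/Gq->]; rewrite ?mul0r ?mulr0 eqxx.
Qed.

Lemma zirreducible_zclosure (A : set space) :
  zirreducible A -> zirreducible (zclosure A).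
Proof.
case=> [[a Aa] irrA]; split; first by exists a; exact: subset_zclosure.
move=> F G cF cG AFG.
have /irrA [] // : A `<=` F `|` G.
- exact: subset_trans (@subset_zclosure A) AFG.
- by move=> AF; left; apply: zclosure_min.
- by move=> AG; right; apply: zclosure_min.
Qed.

(** Otherwise each [F j] has a polynomial vanishing on it but not on all of [Z]. Their product over
    [r] vanishes on [Z], and irreducibility strips off its factors one by one until 1 vanishes on
    [Z]. *)
Lemma zirreducible_bigcup (J : eqType) (r : seq J) (F : J -> set space) Z :
  zirreducible Z -> (forall j, zclosed (F j)) ->
  (forall x, Z x -> exists2 j, j \in r & F j x) ->
  exists j, Z `<=` F j.
Proof.
case=> [[z Zz] irrZ] cF HZ.
apply: contrapT => nZ.
have {nZ} /choice[x Hx] : forall j, exists x, Z x /\ ~ F j x.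
  move=> j; apply: contrapT => H; apply: nZ; exists j => x Zx.
  by apply: contrapT => Fx; apply: H; exists x.
have /choice[p Hp] : forall j, exists p,
    (forall y, F j y -> peval y p = 0) /\ peval (x j) p != 0.
  by move=> j; apply: zclosed_separate => //; case: (Hx j).
have H0 : forall y, Z y -> \prod_(j <- r) peval y (p j) = 0.
  move=> y /HZ[j jr Fy]; apply/eqP; rewrite prodf_seq_eq0.
  by apply/hasP; exists j => //=; case: (Hp j) => /(_ _ Fy) ->.
elim: r {HZ} H0 => [|j r IHr] H.
  by have /eqP := H z Zz; rewrite big_nil oner_eq0.
apply: IHr.
have [||||H'|//] := @zirreducible_prod Z (fun y => peval y (p j))
   (fun y => \prod_(k <- r) peval y (p k)).
- by split; first exists z.
- by exists (p j).
- by apply: (subalg_prod polyfun_subalg) => k; exists (p k).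
- by move=> y Zy; have := H y Zy; rewrite big_cons.
have [Zx _] := Hx j; have [_] := Hp j.
by rewrite H' // eqxx.
Qed.

End PolynomialFunctions.

(** * Polynomial curves and irreducibility *)

Section UnivariatePolynomialFunctions.
Variable K : numFieldType.

Definition upoly (f : K -> K) := exists p : {poly K}, forall t, f t = p.[t].

Lemma upoly_subalg : is_subalg upoly.
Proof.
split=> [a|f g [p Hp] [q Hq]|f g [p Hp] [q Hq]].
- by exists a%:P => t; rewrite hornerC.
- by exists (p + q) => t; rewrite hornerD Hp Hq.
- by exists (p * q) => t; rewrite hornerM Hp Hq.
Qed.

Lemma upoly_id : upoly id.
Proof. by exists 'X => t; rewrite hornerX. Qed.

Lemma upoly_cst (a : K) : upoly (fun=> a).
Proof. exact: (subalg_cst upoly_subalg). Qed.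

Lemma upolyD f g : upoly f -> upoly g -> upoly (fun t => f t + g t).
Proof. exact: (subalgD upoly_subalg). Qed.

Lemma upolyM f g : upoly f -> upoly g -> upoly (fun t => f t * g t).
Proof. exact: (subalgM upoly_subalg). Qed.

Lemma upoly_affine (a b : K) : upoly (fun t => a + t * b).
Proof.
apply: upolyD; first exact: upoly_cst.
by apply: upolyM; [exact: upoly_id|exact: upoly_cst].
Qed.

Lemma upoly_neq0M f g s t : upoly f -> upoly g -> f s != 0 -> g t != 0 ->
  exists u, f u * g u != 0.
Proof.
case=> p Hp [q Hq]; rewrite Hp Hq => ps qt.
have pq0 : p * q != 0.
  rewrite mulf_neq0 //.
    by apply: contraNneq ps => ->; rewrite horner0.
  by apply: contraNneq qt => ->; rewrite horner0.
apply: contrapT => H.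
(* One more integer than the degree of [p * q]; they are distinct in characteristic 0. *)
pose r : seq K := [seq i%:R | i <- iota 0 (size (p * q))].
have r_uniq : uniq r.
  by rewrite map_inj_uniq ?iota_uniq // => i j /eqP; rewrite eqr_nat => /eqP.
have r_roots : all (root (p * q)) r.
  apply/allP => u _; apply: contrapT => nu; apply: H; exists u.
  by rewrite Hp Hq -hornerM; apply/negP.
have := max_poly_roots pq0 r_roots r_uniq.
by rewrite size_map size_iota ltnn.
Qed.

End UnivariatePolynomialFunctions.

Section RationalPaths.
Variables (K : numFieldType) (I : finType).
Local Notation space := {ffun I -> K}.

Lemma upoly_peval (g : K -> space) p :
  (forall i, upoly (fun t => g t i)) -> upoly (fun t => peval (g t) p).
Proof. by move=> gpoly; apply: (subalg_peval p (upoly_subalg K)). Qed.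

(** If [p] vanishes on [A], then [p] along [g] vanishes wherever [D] does not, hence identically. *)
Lemma zclosure_path (A : set space) (g : K -> space) (D : K -> K) s t :
  (forall i, upoly (fun t => g t i)) -> upoly D -> D s != 0 ->
  (forall u, D u != 0 -> A (g u)) -> zclosure A (g t).
Proof.
move=> gpoly Dpoly Ds HD; apply/zclosureP => p Ap.
apply/eqP; apply: contrapT => /negP pt.
have [u] := upoly_neq0M Dpoly (upoly_peval p gpoly) Ds pt.
rewrite mulf_eq0 negb_or => /andP[Du /eqP]; apply.
by apply: Ap; apply: HD.
Qed.

(* Two points joined by a polynomial curve generically contained in A cannot be
separated by two closed sets covering A. *)
Lemma zirreducible_path (A : set space) : A !=set0 ->
  (forall a b, A a -> A b -> exists (g : K -> space) (D : K -> K) (s t u : K),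
     [/\ forall i, upoly (fun t => g t i), upoly D,
         forall v, D v != 0 -> A (g v) & [/\ D s != 0, g t = a & g u = b]]) ->
  zirreducible A.
Proof.
move=> A0 HA; apply: zirreducible_pevalI => // p q a b Aa Ab pa qb.
have [g [D [s [t [u [gpoly Dpoly HD [Ds ga gb]]]]]]] := HA a b Aa Ab.
rewrite -ga in pa; rewrite -gb in qb.
have pp := upoly_peval p gpoly; have qp := upoly_peval q gpoly.
have [v pqv] := upoly_neq0M pp qp pa qb.
have [w] := upoly_neq0M Dpoly (upolyM pp qp) Ds pqv.
rewrite mulf_eq0 negb_or => /andP[Dw pqw].
by exists (g w) => //; apply: HD.
Qed.

(** Segments in [P] map to polynomial curves lying entirely in the image, so [D] can be constant. *)
Lemma zirreducible_image (J : finType) (P : set {ffun J -> K})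
    (Phi : {ffun J -> K} -> space) : P !=set0 ->
  (forall i, polyfun (fun x => Phi x i)) ->
  (forall x y t, P x -> P y -> P [ffun j => x j + t * (y j - x j)]) ->
  zirreducible (Phi @` P).
Proof.
move=> [x0 Px0] Phip Pconv; apply: zirreducible_path.
  by exists (Phi x0), x0.
move=> _ _ [x Px <-] [y Py <-].
pose l t : {ffun J -> K} := [ffun j => x j + t * (y j - x j)].
exists (fun t => Phi (l t)), (fun=> 1), 0, 0, 1; split.
- move=> i; have [p Hp] := Phip i; under eq_fun do rewrite Hp.
  apply: (subalg_peval p (upoly_subalg K)) => j.
  by under eq_fun do rewrite ffunE; apply: upoly_affine.
- exact: upoly_cst.
- by move=> v _; exists (l v) => //; apply: Pconv.
- split; first exact: oner_neq0.
    by congr Phi; apply/ffunP => j; rewrite ffunE mul0r addr0.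
  by congr Phi; apply/ffunP => j; rewrite ffunE mul1r addrC subrK.
Qed.

End RationalPaths.

(** * Linear independence on irreducible sets *)

Section Dimension.
Variables (K : fieldType) (I : finType).
Local Notation space := {ffun I -> K}.

Definition free_on (J : finType) (Z : set space) (m : J -> {mpoly K[#|I|]}) :=
  forall a : J -> K, (forall x, Z x -> \sum_j a j * peval x (m j) = 0) ->
  forall j, a j = 0.

(* In a relation on Z', cancel the lowest power of f (Z' is irreducible) and restrict
to Z, where f vanishes: the lowest coefficients form a relation on Z. *)
Lemma free_on_mul_powers (J : finType) (Z Z' : set space)
    (m : J -> {mpoly K[#|I|]}) f N :
  Z `<=` Z' -> zirreducible Z' -> (forall x, Z x -> peval x f = 0) ->
  (exists2 x, Z' x & peval x f != 0) -> free_on Z m ->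
  free_on Z' (fun u : 'I_N * J => f ^+ u.1 * m u.2).
Proof.
move=> ZZ' irrZ' Zf [x0 Zx0 fx0] free a Ha.
suff H : forall k (i : 'I_N), (i < k)%N -> forall j, a (i, j) = 0.
  by case=> i j; apply: (H i.+1).
elim=> // k IHk i; rewrite ltnS leq_eqVlt => /orP[/eqP ik|]; last exact: IHk.
(* The relation divided by [f ^+ k], its coefficients below [k] being already known to vanish. *)
pose g x := \sum_(u : 'I_N * J | (k <= u.1)%N)
  a u * (peval x f ^+ (u.1 - k) * peval x (m u.2)).
have pg : polyfun g.
  apply: (subalg_sum (polyfun_subalg K I)) => u.
  apply: (subalgM (polyfun_subalg K I)).
    exact: (subalg_cst (polyfun_subalg K I)).
  apply: (subalgM (polyfun_subalg K I)); last by exists (m u.2).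
  by apply: (subalgX (polyfun_subalg K I)); exists f.
have Hfg x : Z' x -> peval x f ^+ k * g x = 0.
  move=> Z'x; rewrite -[RHS](Ha x Z'x) [RHS](bigID (fun u : 'I_N * J => (k <= u.1)%N)) /=.
  rewrite [X in _ = _ + X]big1 ?addr0 => [|[i' j'] /=]; last first.
    by rewrite -ltnNge => lt; rewrite (IHk i' lt) mul0r.
  rewrite mulr_sumr; apply: eq_bigr => u ku.
  rewrite mulrCA; congr (_ * _); rewrite mulrA -exprD subnKC //.
  by rewrite /peval mevalM rmorphXn.
have [|Hk|Hg] := zirreducible_prod irrZ' _ pg Hfg.
- by apply: (subalgX (polyfun_subalg K I)); exists f.
- by have /eqP := Hk _ Zx0; rewrite expf_eq0 (negbTE fx0) andbF.
suff Hj : forall j, a (i, j) = 0 by [].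
apply: (free (fun j => a (i, j))) => x Zx.
rewrite -[RHS](Hg x (ZZ' x Zx)) /g.
rewrite (bigID (fun u : 'I_N * J => u.1 == i)) /= [X in _ = _ + X]big1 ?addr0; last first.
  move=> u /andP[ku ui]; rewrite Zf // expr0n subn_eq0.
  have -> : (u.1 <= k)%N = false.
    by apply: contraNF ui => uk; rewrite -val_eqE /= eqn_leq ik uk ku.
  by rewrite mul0r mulr0.
rewrite (reindex (fun j => (i, j))) /=; last first.
  exists snd => [j|[i' j]] //=.
  by rewrite inE /= => /andP[_ /eqP->].
apply: eq_big => [j|j _]; first by rewrite ik leqnn eqxx.
by rewrite ik subnn expr0 mul1r.
Qed.

End Dimension.

(** * Dimension of sets covered by polynomial images *)

Section PolynomialDegrees.
Variables (K : fieldType) (n : nat).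
Implicit Types p q : {mpoly K[n]}.

Lemma msizeM_leD p q a b : (msize p <= a.+1)%N -> (msize q <= b.+1)%N ->
  (msize (p * q) <= (a + b).+1)%N.
Proof.
have [->|p0] := eqVneq p 0; first by rewrite mul0r msize0.
have [->|q0] := eqVneq q 0; first by rewrite mulr0 msize0.
by rewrite msizeM //; move: (msize p) (msize q) => u v; lia.
Qed.

Lemma msizeX_le p a k : (msize p <= a.+1)%N -> (msize (p ^+ k) <= (k * a).+1)%N.
Proof.
move=> pa; elim: k => [|k IHk]; first by rewrite expr0 msize1.
by rewrite exprS mulSn; apply: msizeM_leD.
Qed.

Lemma msize_prod_le (J : Type) (r : seq J) (p : J -> {mpoly K[n]}) (a : J -> nat) :
  (forall j, msize (p j) <= (a j).+1)%N ->
  (msize (\prod_(j <- r) p j) <= (\sum_(j <- r) a j).+1)%N.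
Proof.
move=> pa; elim: r => [|j r IHr]; first by rewrite !big_nil msize1.
by rewrite !big_cons; apply: msizeM_leD.
Qed.

Lemma msize_sum_le (J : eqType) (r : seq J) (p : J -> {mpoly K[n]}) a :
  (forall j, j \in r -> msize (p j) <= a)%N -> (msize (\sum_(j <- r) p j) <= a)%N.
Proof.
elim: r => [|j r IHr] pa; first by rewrite big_nil msize0.
rewrite big_cons (leq_trans (msizeD_le _ _)) // geq_max pa ?mem_head //=.
by apply: IHr => k kr; rewrite pa // inE kr orbT.
Qed.

(* There are at most M ^ n monomials of degree less than M. *)
Lemma mpoly_dependent (J : finType) M (p : J -> {mpoly K[n]}) :
  (forall j, msize (p j) <= M)%N -> (M ^ n < #|J|)%N ->
  exists2 a : J -> K, (exists j, a j != 0) & \sum_j a j *: p j = 0.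
Proof.
move=> pM MJ; pose E := {ffun 'I_n -> 'I_M}.
(* Each row lists the coefficients of one [p j]. There are [M ^ n] columns, fewer than rows, and a
   nonzero vector of the left kernel is the relation. *)
pose A : 'M[K]_(#|J|, #|{: E}|) :=
  \matrix_(i, k) (p (enum_val i))@_[multinom ((enum_val k : E) l : nat) | l < n].
have : kermx A != 0.
  rewrite kermx_eq0 /row_free; apply: contraTneq MJ => rA.
  by rewrite -leqNgt -rA (leq_trans (rank_leq_col A)) // card_ffun !card_ord.
case/rowV0Pn => v /sub_kermxP vA v0.
have [i vi] : exists i, v 0 i != 0.
  apply: contrapT => H; case/negP: v0; apply/eqP/rowP => i.
  by rewrite mxE; apply: contrapT => /eqP vi; apply: H; exists i.
exists (fun j => v 0 (enum_rank j)); first by exists (enum_val i); rewrite enum_valK.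
apply/mpolyP => m; rewrite mcoeff0 raddf_sum /=.
under eq_bigr do rewrite mcoeffZ.
have [mM|Mm] := ltnP (mdeg m) M; last first.
  rewrite big1 // => j _; apply/eqP; rewrite mulf_eq0; apply/orP; right.
  by rewrite mcoeff_eq0 msize_mdeg_ge // (leq_trans (pM j)).
have lM l : (m l < M)%N.
  by rewrite (leq_ltn_trans _ mM) // mdegE (bigD1 l) //= leq_addr.
have /rowP/(_ (enum_rank ([ffun l => Ordinal (lM l)] : E))) := vA.
rewrite !mxE => vAm; rewrite -[RHS]vAm (reindex (@enum_val J predT)) /=; last first.
  by apply: onW_bij; apply: enum_val_bij.
apply: eq_bigr => k _; rewrite enum_valK mxE; congr (_ * _@__).
by apply/mnmP => l; rewrite mnmE enum_rankK ffunE.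
Qed.

End PolynomialDegrees.

Section Dimension.
Variables (K : fieldType) (I : finType).
Local Notation space := {ffun I -> K}.

(** Degrees multiply under substitution; [msize] is one more than the degree of a nonzero
    polynomial, hence the successors. *)
Lemma peval_comp (J : finType) (Phi : {ffun J -> K} -> space)
    (q : I -> {mpoly K[#|J|]}) C M p :
  (forall x i, Phi x i = peval x (q i)) -> (forall i, msize (q i) <= C.+1)%N ->
  (msize p <= M.+1)%N ->
  exists2 P, (msize P <= (M * C).+1)%N & forall x, peval (Phi x) p = peval x P.
Proof.
move=> Hq qC pM.
exists (\sum_(m <- msupp p) p@_m *: \prod_k q (enum_val k) ^+ m k) => [|x].
  apply: msize_sum_le => m mp; rewrite (leq_trans (msizeZ_le _ _)) //.
  apply: leq_trans (msize_prod_le _ (fun k => msizeX_le (m k) (qC (enum_val k)))) _.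
  rewrite -big_distrl -mdegE /= ltnS leq_mul2r.
  by apply/orP; right; rewrite -ltnS; apply: leq_trans pM; apply: msize_mdeg_lt.
rewrite /peval mevalE rmorph_sum /=; apply: eq_bigr => m _.
rewrite mevalZ rmorph_prod; congr (_ * _); apply: eq_bigr => k _.
by rewrite rmorphXn Hq.
Qed.

Lemma irr_chainS (X : set space) n Z : irr_chain X n.+1 Z -> irr_chain X n Z.
Proof.
by case=> H1 H2; split=> i lei; [apply: H1; apply: leqW|apply: H2; apply: ltnW].
Qed.

(** Each step of the chain gives [f] vanishing on [Z n] but not on [Z n.+1], and its first [N]
    powers multiply the size of the family by [N]. The slope [E] is fixed before [N], so the degrees
    grow only linearly in [N]. *)
Lemma irr_chain_free (X : set space) n Z : irr_chain X n Z ->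
  exists E, forall N, exists (J : finType) (m : J -> {mpoly K[#|I|]}),
    [/\ #|J| = (N ^ n)%N, forall j, (msize (m j) <= (E * N).+1)%N & free_on (Z n) m].
Proof.
elim: n => [|n IHn] chZ.
  exists 0%N => N; exists unit, (fun=> 1); split=> [|j|a Ha j].
  - by rewrite card_unit.
  - by rewrite msize1.
  have [_ [[x Zx] _]] := chZ.1 0%N isT.
  have := Ha x Zx; rewrite (big_pred1 tt) => [|[]//].
  by rewrite /peval meval1 mulr1; case: j.
have [E HE] := IHn (irr_chainS chZ).
have [[F [cF ZF]] irrZ] := chZ.1 n (leqnSn n).
have [[G [cG ZG]] irrZ'] := chZ.1 n.+1 (leqnn _).
have [ZZ' nZ'] := chZ.2 n (leqnn _).
have [x Z'x nZx] : exists2 x, Z n.+1 x & ~ Z n x.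
  apply: contrapT => H; apply: nZ' => x Z'x.
  by apply: contrapT => nZx; apply: H; exists x.
have nFx : ~ F x.
  by move=> Fx; apply: nZx; rewrite ZF; split=> //; move: Z'x; rewrite ZG => -[].
have [f [Ff fx]] := zclosed_separate cF nFx.
exists (E + msize f)%N => N; have [J [m [cardJ mE free]]] := HE N.
exists ('I_N * J)%type, (fun u : 'I_N * J => f ^+ u.1 * m u.2); split.
- by rewrite card_prod card_ord cardJ expnS.
- move=> [k j] /=; rewrite mulnDl addnC.
  apply: msizeM_leD => //; apply: leq_trans (msizeX_le _ (leqnSn _)) _.
  by rewrite ltnS mulnC leq_mul2l ltnW ?orbT.
apply: free_on_mul_powers irrZ' _ _ free => //.
  by move=> y; rewrite ZF => -[_ /Ff].
by exists x.
Qed.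

(* The N ^ n monomials of degree O(N) that are independent on Z n pull back to
independent polynomials of degree O(N) on K ^ J, a space of dimension O(N ^ #|J|). *)
Theorem irr_chain_le_dim (X : set space) (J : finType) (S : eqType) (r : seq S)
    (Phi : S -> {ffun J -> K} -> space) n Z :
  (forall s i, polyfun (fun x => Phi s x i)) ->
  (forall x, X x -> exists2 s, s \in r & zclosure (range (Phi s)) x) ->
  irr_chain X n Z -> (n <= #|J|)%N.
Proof.
move=> Phip XPhi chZ; rewrite leqNgt; apply/negP => Jn.
have [s Zs] : exists s, Z n `<=` zclosure (range (Phi s)).
  have [[F [_ ZF]] irrZ] := chZ.1 n (leqnn n).
  apply: (@zirreducible_bigcup _ _ _ r) irrZ _ _ => [s|x]; first exact: zclosed_zclosure.
  by rewrite ZF => -[/XPhi].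
have /choice[q Hq] : forall i, exists q, forall x, Phi s x i = peval x q.
  by move=> i; apply: Phip.
pose C := (\max_i msize (q i))%N.
have qC i : (msize (q i) <= C.+1)%N by rewrite leqW // leq_bigmax.
have [E HE] := irr_chain_free chZ.
(* Chosen so that [N ^ #|J|.+1] exceeds [((E * C).+1 * N) ^ #|J|], which bounds the number of
   monomials of degree at most [E * N * C]. *)
pose N := ((E * C).+1 ^ #|J|).+1.
have [L [m [cardL mE free]]] := HE N.
have /choice[P HP] : forall l, exists P, (msize P <= (E * N * C).+1)%N /\
    forall x, peval (Phi s x) (m l) = peval x P.
  by move=> l; have [P] := peval_comp (fun x i => Hq i x) qC (mE l); exists P.
have [||a [l al] aP] := @mpoly_dependent K #|J| L (E * N * C).+1 P.
- by move=> l; case: (HP l).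
- rewrite cardL; apply: (@leq_trans (N ^ #|J|.+1)); last first.
    by rewrite leq_pexp2l.
  apply: (@leq_ltn_trans (((E * C).+1 * N) ^ #|J|)).
    have [->|J0] := posnP #|J|; first by rewrite !expn0.
    by rewrite leq_exp2r // mulSn mulnAC /N; lia.
  rewrite expnMn expnS ltn_mul2r expn_gt0 /=.
  by rewrite /N ltnSn.
case/negP: al; apply/eqP; apply: free => x /Zs Zx.
have pf : polyfun (fun x => \sum_l a l * peval x (m l)).
  apply: (subalg_sum (polyfun_subalg K I)) => k.
  apply: (subalgM (polyfun_subalg K I)); last by exists (m k).
  exact: (subalg_cst (polyfun_subalg K I)).
apply: (zclosure_polyfun pf _ Zx) => _ [y _ <-].
have := congr1 (peval y) aP; rewrite /peval meval0 raddf_sum /= => aPy.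
rewrite -[RHS]aPy.
by apply: eq_bigr => k _; rewrite mevalZ; congr (_ * _); exact: (HP k).2.
Qed.

End Dimension.

(** * Structure constants *)


Section StructureConstants.
Variable K : fieldType.
Implicit Types (c d : structure3 K) (x y : 'cV[K]_3) (l : 'rV[K]_3).
Implicit Types (B S g : 'M[K]_3).

Definition i0 : 'I_3 := ord0.
Definition i1 : 'I_3 := @Ordinal 3 1 isT.
Definition i2 : 'I_3 := @Ordinal 3 2 isT.

Lemma ord3_ind (P : 'I_3 -> Prop) : P i0 -> P i1 -> P i2 -> forall i, P i.
Proof.
move=> P0 P1 P2 [[|[|[|//]]] lti].
- by rewrite (_ : Ordinal lti = i0) //; apply: val_inj.
- by rewrite (_ : Ordinal lti = i1) //; apply: val_inj.
- by rewrite (_ : Ordinal lti = i2) //; apply: val_inj.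
Qed.

Lemma sum3 (V : nmodType) (F : 'I_3 -> V) : \sum_i F i = F i0 + F i1 + F i2.
Proof.
rewrite !big_ord_recl big_ord0 addr0 addrA.
by congr (_ + F _ + F _); apply: val_inj.
Qed.

Lemma mulmx_e m (A : 'M[K]_(m, 3)) i : A *m e_ K i = col i A.
Proof. by rewrite /e_ -colE. Qed.

Lemma alg_mulDl c x x' y : alg_mul c (x + x') y = alg_mul c x y + alg_mul c x' y.
Proof.
apply/colP => k; rewrite !mxE -big_split; apply: eq_bigr => i _ /=.
by rewrite -big_split; apply: eq_bigr => j _; rewrite mxE mulrDr mulrDl.
Qed.

Lemma alg_mulDr c x y y' : alg_mul c x (y + y') = alg_mul c x y + alg_mul c x y'.
Proof.
apply/colP => k; rewrite !mxE -big_split; apply: eq_bigr => i _ /=.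
by rewrite -big_split; apply: eq_bigr => j _; rewrite mxE mulrDr.
Qed.

Lemma alg_mulZl c a x y : alg_mul c (a *: x) y = a *: alg_mul c x y.
Proof.
apply/colP => k; rewrite !mxE mulr_sumr; apply: eq_bigr => i _ /=.
by rewrite mulr_sumr; apply: eq_bigr => j _; rewrite mxE; ring.
Qed.

Lemma alg_mulZr c a x y : alg_mul c x (a *: y) = a *: alg_mul c x y.
Proof.
apply/colP => k; rewrite !mxE mulr_sumr; apply: eq_bigr => i _ /=.
by rewrite mulr_sumr; apply: eq_bigr => j _; rewrite mxE; ring.
Qed.

Lemma alg_mul0l c y : alg_mul c 0 y = 0.
Proof. by have := alg_mulZl c 0 0 y; rewrite !scale0r. Qed.

Lemma alg_mul0r c x : alg_mul c x 0 = 0.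
Proof. by have := alg_mulZr c 0 x 0; rewrite !scale0r. Qed.

Lemma alg_mul_suml c (J : Type) (r : seq J) (x : J -> 'cV[K]_3) y :
  alg_mul c (\sum_(j <- r) x j) y = \sum_(j <- r) alg_mul c (x j) y.
Proof.
elim: r => [|j r IHr]; first by rewrite !big_nil alg_mul0l.
by rewrite !big_cons alg_mulDl IHr.
Qed.

Lemma alg_mul_sumr c (J : Type) (r : seq J) x (y : J -> 'cV[K]_3) :
  alg_mul c x (\sum_(j <- r) y j) = \sum_(j <- r) alg_mul c x (y j).
Proof.
elim: r => [|j r IHr]; first by rewrite !big_nil alg_mul0r.
by rewrite !big_cons alg_mulDr IHr.
Qed.

Lemma alg_mul_e c i j k : alg_mul c (e_ K i) (e_ K j) k 0 = c (i, j, k).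
Proof.
rewrite mxE (bigD1 i) //= [X in _ + X]big1 ?addr0 => [|u /negbTE ui]; last first.
  by apply: big1 => v _; rewrite !mxE ui mulr0 mul0r.
rewrite (bigD1 j) //= big1 ?addr0 => [|v /negbTE vj].
  by rewrite !mxE !eqxx !mulr1.
by rewrite [e_ K j v 0]mxE vj mulr0.
Qed.

Lemma structure3P c d :
  (forall i j, alg_mul c (e_ K i) (e_ K j) = alg_mul d (e_ K i) (e_ K j)) -> c = d.
Proof.
by move=> cd; apply/ffunP => -[[i j] k]; rewrite -!alg_mul_e cd.
Qed.

Lemma gactE g c i j k : gact g c (i, j, k) =
  \sum_l g k l * \sum_u \sum_v c (u, v, l) * invmx g u i * invmx g v j.
Proof.
rewrite ffunE /= mxE; apply: eq_bigr => l _; rewrite mxE; congr (_ * _).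
apply: eq_bigr => u _; apply: eq_bigr => v _.
by rewrite !mulmx_e ![col _ _ _ _]mxE.
Qed.

Lemma gact1 c : gact 1%:M c = c.
Proof.
by apply: structure3P => i j; rewrite mul_gact invmx1 !mul1mx.
Qed.

Lemma gactM g h c : g \in unitmx -> h \in unitmx ->
  gact (g *m h) c = gact g (gact h c).
Proof.
move=> gu hu; apply: structure3P => i j.
have ghV : invmx (g *m h) = invmx h *m invmx g := invrM gu hu.
by rewrite !mul_gact -mulmxA ghV -!mulmxA.
Qed.

Lemma GLorbit_refl c : GLorbit c c.
Proof. by exists 1%:M; rewrite ?unitmx1 ?gact1. Qed.

Lemma GLorbit_gact g c d : g \in unitmx -> GLorbit c d -> GLorbit c (gact g d).
Proof.
by move=> gu [h hu ->]; exists (g *m h); rewrite ?unitmx_mul ?gu // gactM.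
Qed.

Lemma GLorbit_sym c d : GLorbit c d -> GLorbit d c.
Proof.
case=> g gu ->; exists (invmx g); rewrite ?unitmx_inv //.
by rewrite -gactM ?unitmx_inv // mulVmx // gact1.
Qed.

Lemma GLorbit_trans a c d : GLorbit c a -> GLorbit a d -> GLorbit c d.
Proof. by move=> ca [g gu ->]; apply: GLorbit_gact. Qed.

Lemma GLorbit_isomorphic c d : GLorbit c d -> alg_isomorphic c d.
Proof.
by case=> g gu ->; exists g => // x y; rewrite mul_gact !mulKmx.
Qed.

Lemma metabelian_gact g c : g \in unitmx ->
  metabelian_commutative K c -> metabelian_commutative K (gact g c).
Proof.
move=> gu [cC cM]; split=> [x y|x y z t]; first by rewrite !mul_gact cC.
by rewrite !mul_gact !mulKmx // cM mulmx0.
Qed.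

Definition rank1_structure B (w : 'cV[K]_3) : structure3 K :=
  [ffun p => B p.1.1 p.1.2 * w p.2 0].

Definition linear_structure l S : structure3 K :=
  [ffun p => l 0 p.1.1 * S p.2 p.1.2 + l 0 p.1.2 * S p.2 p.1.1].

Lemma mul_rank1_structure B w x y :
  alg_mul (rank1_structure B w) x y = (x^T *m B *m y) 0 0 *: w.
Proof.
apply/colP => k; rewrite !mxE exchange_big mulr_suml /=.
apply: eq_bigr => j _; rewrite mxE !mulr_suml.
by apply: eq_bigr => i _; rewrite ffunE mxE /=; ring.
Qed.

Lemma mul_linear_structure l S x y : alg_mul (linear_structure l S) x y =
  (l *m x) 0 0 *: (S *m y) + (l *m y) 0 0 *: (S *m x).
Proof.
apply/colP => k; rewrite !mxE !mulr_suml.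
transitivity (\sum_i \sum_j l 0 i * S k j * x i 0 * y j 0 +
              \sum_i \sum_j l 0 j * S k i * x i 0 * y j 0).
  rewrite -big_split; apply: eq_bigr => i _.
  by rewrite -big_split; apply: eq_bigr => j _; rewrite ffunE /=; ring.
congr (_ + _); last rewrite exchange_big.
  apply: eq_bigr => i _; rewrite mulr_sumr.
  by apply: eq_bigr => j _; ring.
apply: eq_bigr => i _; rewrite mulr_sumr.
by apply: eq_bigr => j _; ring.
Qed.

End StructureConstants.


(** * Normal forms of metabelian commutative products *)

Section Classification.
Variable K : fieldType.
Implicit Types (c d : structure3 K) (x y w : 'cV[K]_3) (l : 'rV[K]_3).
Implicit Types (B S g : 'M[K]_3).

Lemma rank1_structure_eqP c B w :
  (forall i j, alg_mul c (e_ K i) (e_ K j) = B i j *: w) ->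
  c = rank1_structure B w.
Proof.
by move=> H; apply/ffunP => -[[i j] k]; rewrite -alg_mul_e H ffunE !mxE.
Qed.

Lemma linear_structure_eqP c l S :
  (forall i j, alg_mul c (e_ K i) (e_ K j) = l 0 i *: col j S + l 0 j *: col i S) ->
  c = linear_structure l S.
Proof.
by move=> H; apply/ffunP => -[[i j] k]; rewrite -alg_mul_e H ffunE !mxE.
Qed.

Lemma bilinear_form_e B i j : ((e_ K i)^T *m B *m e_ K j) 0 0 = B i j.
Proof. by rewrite /e_ trmx_delta -rowE -colE !mxE. Qed.

Lemma gact_rank1_structure g B w : gact g (rank1_structure B w) =
  rank1_structure ((invmx g)^T *m B *m invmx g) (g *m w).
Proof.
apply: rank1_structure_eqP => i j.
rewrite mul_gact mul_rank1_structure -scalemxAr; congr (_ *: _).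
by rewrite -[RHS]bilinear_form_e trmx_mul !mulmxA.
Qed.

Lemma gact_linear_structure g l S : gact g (linear_structure l S) =
  linear_structure (l *m invmx g) (g *m S *m invmx g).
Proof.
apply: linear_structure_eqP => i j.
rewrite mul_gact mul_linear_structure mulmxDr -!scalemxAr !mulmxA.
by rewrite !mulmx_e !mxE.
Qed.

(** Gram matrix of x1 y3 + x2 y2 + x3 y1, the form of [M07]. *)
Definition antidiag3 : 'M[K]_3 := \matrix_(i, j) ((i + j == 2)%N)%:R.

Definition diag3 (a b c : K) : 'M[K]_3 :=
  \matrix_(i, j) (if i != j then 0 else nth 0 [:: a; b; c] i).

Definition delta2 : 'rV[K]_3 := delta_mx 0 i2.

Lemma M07E : M07 = rank1_structure antidiag3 (e_ K i0).
Proof.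
apply/ffunP => -[[i j] k]; rewrite !ffunE /= !mxE.
by elim/ord3_ind: i; elim/ord3_ind: j => /=; rewrite ?mxE ?mul0r ?mul1r.
Qed.

Lemma M04E a : M04 a = linear_structure delta2 (diag3 1 a 0).
Proof.
apply/ffunP => -[[i j] k]; rewrite !ffunE /= !mxE.
by elim/ord3_ind: i; elim/ord3_ind: j => /=; elim/ord3_ind: k => /=;
  rewrite ?mxE /= ?mul0r ?mul1r ?mulr1 ?mulr0 ?addr0 ?add0r.
Qed.

Lemma antidiag3K : antidiag3 *m antidiag3 = 1%:M.
Proof.
apply/matrixP => i j; rewrite !mxE sum3 !mxE.
by elim/ord3_ind: i; elim/ord3_ind: j => /=; rewrite ?mul0r ?mul1r ?addr0 ?add0r.
Qed.

(** In the basis of the columns of [g], [B] has the Gram matrix of [M07] and [w] is the first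
    vector; [g] is invertible because [antidiag3] is. *)
Lemma M07_orbit B w g : g^T *m B *m g = antidiag3 -> g *m e_ K i0 = w ->
  GLorbit M07 (rank1_structure B w).
Proof.
move=> gB gw.
have gu : g \in unitmx.
  have : (antidiag3 *m (g^T *m B)) *m g = 1%:M by rewrite -mulmxA gB antidiag3K.
  by case/mulmx1_unit.
exists g => //; rewrite M07E gact_rank1_structure gw -gB; congr rank1_structure.
by rewrite !mulmxA -trmx_mul mulmxV // trmx1 mul1mx -mulmxA mulmxV // mulmx1.
Qed.

(** Multiplying [l] by [k] and [S] by [k^-1] leaves the product unchanged, so only the ratio [a] of
    the two eigenvalues of [S] matters. *)
Lemma M04_orbit l S g a k : k != 0 -> g \in unitmx ->
  l *m g = k^-1 *: delta2 -> S *m g = g *m diag3 k (k * a) 0 ->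
  GLorbit (M04 a) (linear_structure l S).
Proof.
move=> k0 gu lg Sg; exists g => //; rewrite M04E gact_linear_structure.
have -> : delta2 = k *: (l *m g) by rewrite lg scalerA mulfV // scale1r.
have -> : diag3 1 a 0 = k^-1 *: diag3 k (k * a) 0.
  apply/matrixP => i j; rewrite !mxE; case: eqP => _ /=; last by rewrite mulr0.
  by elim/ord3_ind: i => /=; rewrite ?mulr0 ?mulVf ?mulKf.
rewrite -scalemxAr -Sg -!scalemxAl -!mulmxA mulmxV // !mulmx1.
by apply/ffunP => p; rewrite !ffunE !mxE; field.
Qed.

Lemma metabelian_rank1 B w : B^T = B -> w^T *m B *m w = 0 ->
  metabelian_commutative K (rank1_structure B w).
Proof.
move=> BT Bw; split=> [x y|x y z t]; rewrite !mul_rank1_structure.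
  have -> : y^T *m B *m x = (x^T *m B *m y)^T by rewrite !trmx_mul trmxK BT mulmxA.
  by rewrite [in RHS]mxE.
rewrite [_^T]linearZ /= -!scalemxAl -!scalemxAr Bw !scaler0 mxE.
by rewrite scale0r.
Qed.

Lemma metabelian_linear l S : l *m S = 0 ->
  metabelian_commutative K (linear_structure l S).
Proof.
move=> lS; split=> [x y|x y z t]; rewrite !mul_linear_structure 1?addrC //.
have lk (u : K) v : l *m (u *: (S *m v)) = 0.
  by rewrite -scalemxAr mulmxA lS mul0mx scaler0.
by rewrite !mulmxDr !lk !addr0 mxE !scale0r addr0.
Qed.

(** Both identities are multilinear, so they need only be tested on basis vectors, where they are
    polynomial equations [f j] in the structure constants. *)
Lemma zclosed_metabelian : zclosed (metabelian_commutative K).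
Proof.
pose J := ('I_3 * 'I_3 * 'I_3 + 'I_3 * 'I_3 * 'I_3 * 'I_3 * 'I_3)%type.
pose f (j : J) (c : structure3 K) : K := match j with
  | inl (i, j, k) => c (i, j, k) - c (j, i, k)
  | inr (i, j, k, l, m) => \sum_a \sum_b c (a, b, m) * c (i, j, a) * c (k, l, b)
  end.
have -> : metabelian_commutative K = [set c | forall j, f j c = 0].
  apply/seteqP; split=> c.
    case=> cC cM [[[i j] k]|[[[[i j] k] l] m]] /=.
      by rewrite -!alg_mul_e cC subrr.
    have := congr1 (fun x : 'cV_3 => x m 0) (cM (e_ K i) (e_ K j) (e_ K k) (e_ K l)).
    rewrite !mxE => cijkl; rewrite -[RHS]cijkl.
    by apply: eq_bigr => a _; apply: eq_bigr => b _; rewrite !alg_mul_e.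
  move=> Hc; have Hd x : x = \sum_i x i 0 *: e_ K i.
    rewrite {1}[x]matrix_sum_delta; apply: eq_bigr => i _.
    by rewrite big_ord1.
  have cC i j : alg_mul c (e_ K i) (e_ K j) = alg_mul c (e_ K j) (e_ K i).
    apply/colP => k; rewrite !alg_mul_e; apply/eqP; rewrite -subr_eq0.
    by apply/eqP; exact: (Hc (inl (i, j, k))).
  have cM i j k (l : 'I_3) : alg_mul c (alg_mul c (e_ K i) (e_ K j))
      (alg_mul c (e_ K k) (e_ K l)) = 0.
    apply/colP => m; rewrite !mxE -[RHS](Hc (inr (i, j, k, l, m))) /=.
    by apply: eq_bigr => a _; apply: eq_bigr => b _; rewrite !alg_mul_e.
  have mulE x y : alg_mul c x y =
      \sum_i \sum_j x i 0 *: (y j 0 *: alg_mul c (e_ K i) (e_ K j)).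
    rewrite {1}[x]Hd {1}[y]Hd alg_mul_suml; apply: eq_bigr => i _.
    rewrite alg_mulZl alg_mul_sumr scaler_sumr; apply: eq_bigr => j _.
    by rewrite alg_mulZr.
  split=> [x y|x y z t].
    rewrite [LHS]mulE [RHS]mulE exchange_big; apply: eq_bigr => i _ /=.
    by apply: eq_bigr => j _; rewrite cC !scalerA mulrC.
  rewrite (mulE x y) (mulE z t) alg_mul_suml big1 // => i _.
  rewrite alg_mul_suml big1 // => j _; rewrite !alg_mulZl.
  rewrite alg_mul_sumr big1 ?scaler0 // => k _.
  rewrite alg_mul_sumr big1 // => l _.
  by rewrite !alg_mulZr cM !scaler0.
have sub := polyfun_subalg K ('I_3 * 'I_3 * 'I_3)%type.
have pc := @polyfun_coord K ('I_3 * 'I_3 * 'I_3)%type.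
apply: zclosed_family => -[[[i j] k]|[[[[i j] k] l] m]] /=.
  exact: (subalgB sub).
apply: (subalg_sum sub) => a; apply: (subalg_sum sub) => b.
by apply: (subalgM sub) => //; apply: (subalgM sub).
Qed.

Lemma mxrank_le1 m n (A : 'M[K]_(m, n)) : (\rank A <= 1)%N ->
  exists (b : 'cV[K]_m) (v : 'rV[K]_n), A = b *m v.
Proof.
move: (col_base A) (row_base A) (mulmx_base A).
case: (\rank A) => [|[|//]] b v <- _; last by exists b, v.
by exists 0, 0; rewrite mul0mx flatmx0 mulmx0.
Qed.

(** The rows of [P] span the algebra square, on which products vanish. Rank at most 1 gives the
    first form or the zero product, and rank 3 forces the zero product. In rank 2 the square is the
    kernel of some [l]; if l(v) = 1, then x - l(x) v and y - l(y) v lie in the square, and expanding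
    their zero product gives the second form. *)
Lemma metabelian_rank1_or_linear c : (2%:R : K) != 0 ->
  metabelian_commutative K c ->
  (exists B w, [/\ B^T = B, w^T *m B *m w = 0 & c = rank1_structure B w]) \/
  (exists l S, l *m S = 0 /\ c = linear_structure l S).
Proof.
move=> nz2 [cC cM].
pose E := ('I_3 * 'I_3)%type.
pose P : 'M[K]_(#|{: E}|, 3) := \matrix_(r, k) c (enum_val r, k).
have PE (a : 'rV_#|{: E}|) : (a *m P)^T =
    \sum_r a 0 r *: alg_mul c (e_ K (enum_val r).1) (e_ K (enum_val r).2).
  apply/colP => k; rewrite summxE !mxE; apply: eq_bigr => r _.
  by rewrite [RHS]mxE alg_mul_e mxE -surjective_pairing.
have sqrP (u v : 'rV_3) : (u <= P)%MS -> (v <= P)%MS -> alg_mul c u^T v^T = 0.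
  case/submxP => a -> /submxP[b ->]; rewrite !PE alg_mul_suml big1 // => r _.
  by rewrite alg_mul_sumr big1 // => s _; rewrite alg_mulZl alg_mulZr cM !scaler0.
have mulP x y : ((alg_mul c x y)^T <= P)%MS.
  have : (alg_mul c x y)^T = \sum_i \sum_j (x i 0 * y j 0) *:
           row (enum_rank (i, j)) P.
    apply/rowP => k; rewrite !mxE summxE; apply: eq_bigr => i _.
    rewrite summxE; apply: eq_bigr => j _.
    by rewrite !mxE enum_rankK; ring.
  move=> ->; apply: summx_sub => i _; apply: summx_sub => j _.
  by apply: scalemx_sub; apply: row_sub.
have zeroP : P = 0 -> c = linear_structure 0 0.
  move=> P0; apply/ffunP => -[[i j] k]; rewrite ffunE !mxE !mul0r addr0.
  by have /matrixP/(_ (enum_rank (i, j)) k) := P0; rewrite !mxE enum_rankK.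
have [rP|] := leqP (\rank P) 1.
  have [b [v Pbv]] := mxrank_le1 rP.
  pose B : 'M[K]_3 := \matrix_(i, j) b (enum_rank (i, j)) 0.
  have cE : c = rank1_structure B v^T.
    apply/ffunP => -[[i j] k].
    have /matrixP/(_ (enum_rank (i, j)) k) := Pbv; rewrite !mxE enum_rankK => ->.
    by rewrite big_ord1 ffunE !mxE.
  have [v0|v0] := eqVneq v 0.
    by right; exists 0, 0; split; [rewrite mulmx0|apply: zeroP; rewrite Pbv v0 mulmx0].
  have [b0|b0] := eqVneq b 0.
    by right; exists 0, 0; split; [rewrite mulmx0|apply: zeroP; rewrite Pbv b0 mul0mx].
  left; exists B, v^T; split=> //.
    apply/matrixP => i j; have := cC (e_ K j) (e_ K i).
    rewrite cE !mul_rank1_structure => /(congr1 trmx).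
    rewrite ![(_ *: _^T)^T]linearZ /= trmxK => /eqP.
    rewrite -subr_eq0 -scalerBl scaler_eq0 (negbTE v0) orbF subr_eq0 => /eqP.
    by rewrite !bilinear_form_e [B^T _ _]mxE.
  (* Since [b] is nonzero, [v] lies in the square, so its product with itself is zero: this is B(v,
     v) = 0. *)
  have vP : (v <= P)%MS.
    have [r br] : exists r, b r 0 != 0.
      apply: contrapT => H; case/negP: b0; apply/eqP/colP => r; rewrite mxE.
      by apply: contrapT => /eqP br; apply: H; exists r.
    have -> : v = (b r 0)^-1 *: row r P.
      by apply/rowP => k; rewrite Pbv !mxE big_ord1 mulKf.
    by apply: scalemx_sub; apply: row_sub.
  have := sqrP v v vP vP; rewrite cE mul_rank1_structure => /eqP.
  rewrite scaler_eq0 trmx_eq0 (negbTE v0) orbF => /eqP vBv.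
  by apply/matrixP => i j; rewrite !ord1 vBv mxE.
move=> rP; right; have [rP3|rP3] := eqVneq (\rank P) 3.
  exists 0, 0; split; first by rewrite mulmx0.
  apply: structure3P => i j; rewrite mul_linear_structure !mul0mx [(0 : 'M_1) 0 0]mxE !scale0r addr0.
  rewrite -[e_ K i]trmxK -[e_ K j]trmxK; apply: sqrP; apply: submx_full.
    by rewrite /row_full rP3.
  by rewrite /row_full rP3.
have rP2 : \rank P = 2.
  by apply/eqP; rewrite eqn_leq rP andbT -ltnS ltn_neqAle rP3 rank_leq_col.
have : kermx P^T != 0 by rewrite kermx_eq0 /row_free mxrank_tr rP2.
case/rowV0Pn => l /sub_kermxP lP l0.
have lmul x y : l *m alg_mul c x y = 0.
  have /submxP[a aP] := mulP x y.
  by rewrite -[alg_mul c x y]trmxK aP trmx_mul mulmxA lP mul0mx.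
(* The square is contained in the kernel of [l], and both have dimension 2. *)
have kerP (u : 'cV_3) : l *m u = 0 -> (u^T <= P)%MS.
  move=> lu; have PkP : (P <= kermx l^T)%MS.
    by apply/sub_kermxP; rewrite -[P]trmxK -trmx_mul lP trmx0.
  have /eqmxP/eqmx_sym e : (P == kermx l^T)%MS.
    rewrite -(mxrank_leqif_eq PkP) rP2 mxrank_ker mxrank_tr.
    by rewrite rank_rV l0.
  by rewrite -e; apply/sub_kermxP; rewrite -trmx_mul lu trmx0.
have [k lk] : exists k, l 0 k != 0.
  apply: contrapT => H; case/negP: l0; apply/eqP/rowP => r; rewrite mxE.
  by apply: contrapT => /eqP br; apply: H; exists r.
have [v lv] : exists v, l *m v = 1%:M.
  exists ((l 0 k)^-1 *: e_ K k).
  by rewrite -scalemxAr mulmx_e; apply/matrixP => i j; rewrite !ord1 !mxE mulVf.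
(* In xy = l(y) xv + l(x) yv - l(x) l(y) vv, the half shares the last term equally between l(y) S(x)
   and l(x) S(y). *)
pose S : 'M[K]_3 := \matrix_(i, j)
  (alg_mul c (e_ K j) v - (2%:R^-1 * l 0 j) *: alg_mul c v v) i 0.
have colS j : col j S = alg_mul c (e_ K j) v - (2%:R^-1 * l 0 j) *: alg_mul c v v.
  by apply/colP => i; rewrite !mxE.
move: S colS => S colS; exists l, S; split.
  apply/rowP => j; have : l *m col j S = 0.
    by rewrite colS mulmxBr -scalemxAr !lmul scaler0 subr0.
  by rewrite -mulmx_e mulmxA mulmx_e => /matrixP/(_ 0 0); rewrite !mxE.
apply: linear_structure_eqP => i j; rewrite !colS.
have kl m : ((e_ K m - l 0 m *: v)^T <= P)%MS.
  apply: kerP; rewrite mulmxBr mulmx_e -scalemxAr lv.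
  by apply/matrixP => i' j'; rewrite !ord1 !mxE mulr1 subrr.
have := sqrP _ _ (kl i) (kl j); rewrite !trmxK -!scaleNr alg_mulDl !alg_mulDr.
rewrite !alg_mulZl !alg_mulZr (cC v (e_ K j)).
move: (alg_mul c _ _) (alg_mul c _ _) (alg_mul c _ _) (alg_mul c _ _).
move=> xij xi xj xv /colP H; apply/colP => k'; move: (H k'); rewrite !mxE => Hk.
by apply/eqP; rewrite -subr_eq0 -[X in _ == X]Hk; apply/eqP; field.
Qed.

End Classification.

(** * Algebras with one-dimensional square *)


Section BilinearForms.
Variable K : fieldType.
Implicit Types (x y : 'cV[K]_3) (l m : 'rV[K]_3) (B : 'M[K]_3).

Definition form B x y : K := (x^T *m B *m y) 0 0.

Lemma formDl B x x' y : form B (x + x') y = form B x y + form B x' y.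
Proof. by rewrite /form linearD /= !mulmxDl mxE. Qed.

Lemma formDr B x y y' : form B x (y + y') = form B x y + form B x y'.
Proof. by rewrite /form !mulmxDr mxE. Qed.

Lemma formZl B a x y : form B (a *: x) y = a * form B x y.
Proof. by rewrite /form linearZ /= -!scalemxAl mxE. Qed.

Lemma formZr B a x y : form B x (a *: y) = a * form B x y.
Proof. by rewrite /form -!scalemxAr mxE. Qed.

Lemma formC B x y : B^T = B -> form B x y = form B y x.
Proof.
move=> BT; rewrite /form; have -> : y^T *m B *m x = (x^T *m B *m y)^T.
  by rewrite !trmx_mul trmxK BT mulmxA.
by rewrite [in RHS]mxE.
Qed.

Lemma form_e B i j : form B (e_ K i) (e_ K j) = B i j.
Proof. exact: bilinear_form_e. Qed.

Lemma formB B B' x y : form (B - B') x y = form B x y - form B' x y.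
Proof. by rewrite /form mulmxBr mulmxBl !mxE. Qed.

Lemma formD B B' x y : form (B + B') x y = form B x y + form B' x y.
Proof. by rewrite /form mulmxDr mulmxDl !mxE. Qed.

Lemma form_outer l m x y : form (l^T *m m) x y = (l *m x) 0 0 * (m *m y) 0 0.
Proof.
rewrite /form !mulmxA -trmx_mul -mulmxA mxE big_ord1; congr (_ * _).
by rewrite mxE.
Qed.

Lemma rV_neq0P n (l : 'rV[K]_n) : l != 0 -> exists i, l 0 i != 0.
Proof.
move=> l0; apply: contrapT => H; case/negP: l0; apply/eqP/rowP => r; rewrite mxE.
by apply: contrapT => /eqP br; apply: H; exists r.
Qed.

Lemma rV_neq0_dual l : l != 0 -> exists x, l *m x = 1%:M.
Proof.
case/rV_neq0P => i li; exists ((l 0 i)^-1 *: e_ K i).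
by apply/matrixP => j k; rewrite !ord1 -scalemxAr mulmx_e !mxE mulVf.
Qed.

Lemma upper_unitmx (h : 'M[K]_3) : (forall i j : 'I_3, (j < i)%N -> h i j = 0) ->
  (forall i, h i i != 0) -> h \in unitmx.
Proof.
move=> h_up h_diag; rewrite unitmxE -det_tr det_trig; last first.
  by apply/is_trig_mxP => i j ij; rewrite mxE h_up.
by rewrite unitfE; apply/prodf_neq0 => i _; rewrite mxE.
Qed.

Definition row3 l0 l1 l2 : 'M[K]_3 := \matrix_i nth 0 [:: l0; l1; l2] i.
Definition col3 x0 x1 x2 : 'M[K]_3 := \matrix_(i, j) nth 0 [:: x0; x1; x2] j i 0.

Lemma col3E x0 x1 x2 (i : 'I_3) : col3 x0 x1 x2 *m e_ K i = nth 0 [:: x0; x1; x2] i.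
Proof. by rewrite mulmx_e; apply/colP => j; rewrite !mxE. Qed.

Lemma mulmx_row_col3 l0 l1 l2 x0 x1 x2 (i j : 'I_3) :
  (row3 l0 l1 l2 *m col3 x0 x1 x2) i j =
  (nth 0 [:: l0; l1; l2] i *m nth 0 [:: x0; x1; x2] j) 0 0.
Proof.
by rewrite !mxE; apply: eq_bigr => k _; rewrite !mxE.
Qed.

End BilinearForms.

(** * Rank one products: orbit of [M07] or linear structures *)

Section Degenerations.
Variable K : numClosedFieldType.
Implicit Types (c d : structure3 K) (x y w v : 'cV[K]_3) (l : 'rV[K]_3).
Implicit Types (B S g h : 'M[K]_3).

(** By polarization a basis vector or a sum of two has a nonzero value; dividing by a square root
    normalizes it. *)
Lemma symmetric_form_eq1 B : B^T = B -> B != 0 -> exists x, form B x x = 1.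
Proof.
move=> BT B0; suff [x Bx] : exists x, form B x x != 0.
  exists ((sqrtC (form B x x))^-1 *: x).
  by rewrite formZl formZr mulrA -expr2 exprVn sqrtCK mulVf.
have [i [j Bij]] : exists i j, B i j != 0.
  apply: contrapT => H; case/negP: B0; apply/eqP/matrixP => i j; rewrite mxE.
  by apply: contrapT => /eqP Bij; apply: H; exists i, j.
have [Bii|] := eqVneq (B i i) 0; last by exists (e_ K i); rewrite form_e.
have [Bjj|] := eqVneq (B j j) 0; last by exists (e_ K j); rewrite form_e.
exists (e_ K i + e_ K j).
rewrite formDl !formDr (formC (e_ K j) (e_ K i) BT) !form_e Bii Bjj.
by rewrite add0r addr0 -mulr2n mulrn_eq0.
Qed.

(** Take S(x) = m(x) w. *)
Lemma rank1_structure_linear B w l (m : 'rV[K]_3) :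
  l *m w = 0 -> B = l^T *m m + m^T *m l ->
  exists l' S, l' *m S = 0 /\ rank1_structure B w = linear_structure l' S.
Proof.
move=> lw ->; exists l, (w *m m); split; first by rewrite mulmxA lw mul0mx.
by apply/ffunP => -[[i j] k]; rewrite !ffunE !mxE !big_ord1 !mxE /=; ring.
Qed.

(** q^2 + r^2 = (q + i r)(q - i r); the factor 1/2 compensates for symmetrizing the product. *)
Lemma rank1_structure_two_squares w (q r : 'rV[K]_3) :
  q *m w = 0 -> r *m w = 0 -> exists l S, l *m S = 0 /\
    rank1_structure (q^T *m q + r^T *m r) w = linear_structure l S.
Proof.
move=> qw rw.
apply: (@rank1_structure_linear _ _ (q + 'i *: r) (2%:R^-1 *: (q - 'i *: r))).
  by rewrite mulmxDl -scalemxAl qw rw scaler0 addr0.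
apply/matrixP => i j; rewrite !mxE !big_ord1 !mxE.
move: (q 0 i) (q 0 j) (r 0 i) (r 0 j) => a1 a2 a3 a4.
have i2 : 'i * 'i = -1 :> K by rewrite -expr2 sqrCi.
apply/eqP; rewrite -subr_eq0.
have -> : a1 * a2 + a3 * a4 - ((a1 + 'i * a3) * (2^-1 * (a2 - 'i * a4)) +
    2^-1 * (a1 - 'i * a3) * (a2 + 'i * a4)) = a3 * a4 * (1 + 'i * 'i).
  by field.
by rewrite i2 subrr mulr0.
Qed.

(** If [w] is outside the radical of [B], it completes to a hyperbolic pair [w], [f]. The rest of
    [B] is either zero, making [B] a product of two linear forms, or supplies the middle basis
    vector of [M07]. If [w] is in the radical, [B] has rank at most 2 and is a sum of at most two
    squares of linear forms killing [w]. *)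
Lemma rank1_orbit_or_linear B w : B^T = B -> w^T *m B *m w = 0 ->
  GLorbit M07 (rank1_structure B w) \/
  exists l S, l *m S = 0 /\ rank1_structure B w = linear_structure l S.
Proof.
move=> BT Bww.
have nz2 : (2%:R : K) != 0 by rewrite pnatr_eq0.
pose b := form B; have bC x y : b x y = b y x by apply: formC.
have bE := (formDl B, formDr B, formZl B, formZr B).
have bww : b w w = 0 by rewrite /b /form Bww mxE.
have [beta0|beta0] := eqVneq (w^T *m B) 0; last first.
  have [v lv] := rV_neq0_dual beta0.
  have bv : b w v = 1 by rewrite /b /form lv mxE.
  have [f [bf bff]] : exists f, b w f = 1 /\ b f f = 0.
    (* As B(w, w) = 0 and B(w, v) = 1, this multiple of [w] makes the vector isotropic. *)
    exists (v + (- (2%:R^-1 * b v v)) *: w); rewrite /b !bE -/b.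
    by rewrite bww (bC v w) bv; split; field.
  (* [B] with the hyperbolic plane of [w] and [f] split off: both lie in the radical of [Q]. *)
  pose Q := B - ((f^T *m B)^T *m (w^T *m B) + (w^T *m B)^T *m (f^T *m B)).
  have QE x : form Q x x = b x x - (b f x * b w x) *+ 2.
    by rewrite formB formD !form_outer -/(form B f x) -/(form B w x) -/b; ring.
  have QT : Q^T = Q.
    have trE (l m : 'rV[K]_3) : (l^T *m m)^T = m^T *m l by rewrite trmx_mul trmxK.
    by rewrite linearB linearD /= !trE BT [X in _ - X]addrC.
  have [Q0|/(symmetric_form_eq1 QT)[x]] := eqVneq Q 0.
    right; apply: (@rank1_structure_linear _ _ (w^T *m B) (f^T *m B)) => //.
    by apply/eqP; rewrite addrC -subr_eq0; apply/eqP.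
  rewrite QE => Qx; left.
  (* Projection of [x] to the orthogonal of [w] and [f], where [B] and [Q] agree. *)
  pose f2 := x + (- b f x) *: w + (- b w x) *: f.
  apply: (@M07_orbit _ _ _ (col3 w f2 f)); last by rewrite col3E.
  apply/matrixP => i j; rewrite -form_e /form !mulmxA -trmx_mul -mulmxA !col3E.
  rewrite -/(form _ _ _) -/b mxE.
  have bf2w : b w f2 = 0 by rewrite /b /f2 !bE -/b bww bf; ring.
  have bf2f : b f f2 = 0 by rewrite /b /f2 !bE -/b bff (bC f w) bf; ring.
  have bf2f2 : b f2 f2 = 1.
    rewrite /b {1}/f2 formDl formDl !formZl -/b bf2w bf2f /b /f2 !bE -/b.
    by rewrite -Qx (bC x w) (bC x f); ring.
  by elim/ord3_ind: i; elim/ord3_ind: j => //=; rewrite bC.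
right.
have [w0|w0] := eqVneq w 0.
  exists 0, 0; rewrite mulmx0; split=> //.
  by apply/ffunP => p; rewrite !ffunE w0 !mxE mulr0 !mul0r addr0.
have [B0|/(symmetric_form_eq1 BT)[v bv]] := eqVneq B 0.
  by apply: (@rank1_structure_linear _ _ 0 0); rewrite ?mul0mx // B0 !mulmx0 addr0.
have Bw : B *m w = 0 by rewrite -[B *m w]trmxK trmx_mul BT beta0 trmx0.
(* The radical contains [w]; subtracting the square of [q] adds [v] to it, and subtracting that of
   [r] then adds [z]. *)
pose q := v^T *m B.
have qw : q *m w = 0 by rewrite -mulmxA Bw mulmx0.
have qv : q *m v = 1%:M by apply/matrixP => i j; rewrite !ord1 [LHS]bv mxE.
pose B1 := B - q^T *m q.
have B1T : B1^T = B1 by rewrite linearB /= trmx_mul trmxK BT.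
have [B10|/(symmetric_form_eq1 B1T)[z bz]] := eqVneq B1 0.
  apply: (@rank1_structure_linear _ _ q (2%:R^-1 *: q)) => //.
  rewrite [(2^-1 *: _)^T]linearZ /= -scalemxAr -scalemxAl -scalerDl.
  have -> : 2%:R^-1 + 2%:R^-1 = 1 :> K by field.
  by rewrite scale1r; apply/eqP; rewrite -subr_eq0; apply/eqP.
have B1w : B1 *m w = 0 by rewrite mulmxBl Bw -mulmxA qw mulmx0 subr0.
have B1v : B1 *m v = 0.
  by rewrite mulmxBl -mulmxA qv mulmx1 trmx_mul BT trmxK subrr.
pose r := z^T *m B1.
have rw : r *m w = 0 by rewrite -mulmxA B1w mulmx0.
have rv : r *m v = 0 by rewrite -mulmxA B1v mulmx0.
have rz : r *m z = 1%:M by apply/matrixP => i j; rewrite !ord1 [LHS]bz mxE.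
pose B2 := B1 - r^T *m r.
have B20 : B2 = 0.
  have B2w : B2 *m w = 0 by rewrite mulmxBl B1w -mulmxA rw mulmx0 subr0.
  have B2v : B2 *m v = 0 by rewrite mulmxBl B1v -mulmxA rv mulmx0 subr0.
  have B2z : B2 *m z = 0.
    by rewrite mulmxBl -mulmxA rz mulmx1 trmx_mul B1T trmxK subrr.
  have [k wk] : exists k, w k 0 != 0.
    have /rV_neq0P[k] : w^T != 0 by rewrite trmx_eq0.
    by rewrite mxE; exists k.
  (* The pairing with three functionals is upper triangular with nonzero diagonal, so [w], [v], [z]
     form a basis. *)
  have : row3 (delta_mx 0 k) q r *m col3 w v z \in unitmx.
    apply: upper_unitmx => [i j|i]; rewrite mulmx_row_col3.
      by elim/ord3_ind: i; elim/ord3_ind: j => //= _; rewrite ?qw ?rw ?rv mxE.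
    by elim/ord3_ind: i => /=; rewrite ?qv ?rz -?rowE mxE ?oner_eq0.
  rewrite unitmx_mul => /andP[_ Mu]; rewrite -[B2](mulmxK Mu).
  suff -> : B2 *m col3 w v z = 0 by rewrite mul0mx.
  have B2e (j : 'I_3) : B2 *m col3 w v z *m e_ K j = 0.
    by rewrite -mulmxA col3E; elim/ord3_ind: j.
  apply/matrixP => i j; have /matrixP/(_ i 0) := B2e j.
  by rewrite mulmx_e !mxE.
have BE : B = q^T *m q + r^T *m r.
  by apply/eqP; rewrite -subr_eq0 opprD addrA; apply/eqP.
by rewrite BE; apply: rank1_structure_two_squares.
Qed.

End Degenerations.

(** * Degenerations of the family M04 *)


Section LinearStructures.
Variable K : numClosedFieldType.
Implicit Types (l : 'rV[K]_3) (S g h : 'M[K]_3).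

Definition M04_orbits : set (structure3 K) :=
  \bigcup_(a in [set: K]) GLorbit (M04 a).

(** The last row is zero because [delta2] annihilates the image of the operator. *)
Definition triangular3 (a b d s1 s2 : K) : 'M[K]_3 :=
  \matrix_(i, j) nth 0 (nth [::] [:: [:: a; b; s1]; [:: 0; d; s2]; [:: 0; 0; 0]] i) j.

Lemma row_completion l : l != 0 -> exists2 h, h \in unitmx & l *m h = delta2 K.
Proof.
move=> l0; have rl : \rank l = 1%N by rewrite rank_rV l0.
have := mulmx_ebase l; have := col_ebase_unit l; have := row_ebase_unit l.
rewrite rl; set E := row_ebase l; set c := col_ebase l => Eu cu lE.
have c0 : c 0 0 != 0 by move: cu; rewrite unitmxE det_mx11 unitfE.
have Ju : antidiag3 K \in unitmx by case/mulmx1_unit: (antidiag3K K).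
(* [l *m invmx E] is a multiple of the first coordinate functional, which [antidiag3] moves to the
   third. *)
exists (invmx E *m ((c 0 0)^-1 *: antidiag3 K)).
  by rewrite unitmx_mul unitmx_inv Eu unitmxZ ?unitfE ?invr_eq0.
rewrite -lE mulmxA mulmxK // -scalemxAr [c]mx11_scalar mul_scalar_mx -scalemxAl.
rewrite [_%:M 0 0]mxE eqxx mulr1n scalerA mulVf // scale1r.
apply/rowP => i; rewrite mxE sum3 !mxE /=.
by elim/ord3_ind: i; rewrite /= !mul0r !addr0 ?mul1r.
Qed.

Lemma triangularise (A : 'M[K]_3) : delta2 K *m A = 0 ->
  exists2 h, h \in unitmx & delta2 K *m h = delta2 K /\
  exists a b d s1 s2, A *m h = h *m triangular3 a b d s1 s2.
Proof.
move=> dA.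
have A2 j : A i2 j = 0.
  by have /matrixP/(_ 0 j) := dA; rewrite -rowE !mxE.
have [A01|A01] := eqVneq (A i0 i1) 0.
  (* The block on [e_1], [e_2] is lower triangular; exchanging the two vectors makes it upper
     triangular. *)
  pose h : 'M[K]_3 := \matrix_(i, j)
    nth 0 (nth [::] [:: [:: 0; 1; 0]; [:: 1; 0; 0]; [:: 0; 0; 1]] i) j.
  have hh : h *m h = 1%:M.
    apply/matrixP => i j; rewrite !mxE sum3 !mxE.
    by elim/ord3_ind: i; elim/ord3_ind: j => /=; ring.
  exists h; first by case/mulmx1_unit: hh.
  split; first by apply/rowP; elim/ord3_ind; rewrite !mxE sum3 !mxE /=; ring.
  exists (A i1 i1), (A i1 i0), (A i0 i0), (A i1 i2), (A i0 i2).
  apply/matrixP => i j; rewrite !mxE !sum3 !mxE.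
  by elim/ord3_ind: i; elim/ord3_ind: j => /=; rewrite ?A2 ?A01; ring.
(* The condition for e_1 + x e_2 to be an eigenvector of the upper left block. *)
have [x Hx] : exists x, A i0 i1 * x ^+ 2 + (A i0 i0 - A i1 i1) * x - A i1 i0 = 0.
  pose u := A i0 i0 - A i1 i1; pose D := u ^+ 2 + 4%:R * A i0 i1 * A i1 i0.
  have [s sD] : exists s, s ^+ 2 = D by exists (sqrtC D); rewrite sqrtCK.
  exists ((s - u) / (2%:R * A i0 i1)); rewrite -/u.
  have -> : A i1 i0 = (s ^+ 2 - u ^+ 2) / (4%:R * A i0 i1) by rewrite sD /D; field.
  by field.
pose h : 'M[K]_3 := \matrix_(i, j)
  nth 0 (nth [::] [:: [:: 1; 0; 0]; [:: x; 1; 0]; [:: 0; 0; 1]] i) j.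
pose h' : 'M[K]_3 := \matrix_(i, j)
  nth 0 (nth [::] [:: [:: 1; 0; 0]; [:: - x; 1; 0]; [:: 0; 0; 1]] i) j.
have hh : h *m h' = 1%:M.
  apply/matrixP => i j; rewrite !mxE sum3 !mxE.
  by elim/ord3_ind: i; elim/ord3_ind: j => /=; ring.
exists h; first by case/mulmx1_unit: hh.
split; first by apply/rowP; elim/ord3_ind; rewrite !mxE sum3 !mxE /=; ring.
exists (A i0 i0 + x * A i0 i1), (A i0 i1), (A i1 i1 - x * A i0 i1),
  (A i0 i2), (A i1 i2 - x * A i0 i2).
apply/matrixP => i j; rewrite !mxE !sum3 !mxE.
elim/ord3_ind: i; elim/ord3_ind: j => /=; rewrite ?A2; try ring.
by apply/eqP; rewrite -subr_eq0 -oppr_eq0 -[X in _ == X]Hx; apply/eqP; ring.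
Qed.

Lemma triangular_M04_orbits l S h a b d s1 s2 : h \in unitmx ->
  l *m h = delta2 K -> S *m h = h *m triangular3 a b d s1 s2 ->
  a != 0 -> d != 0 -> d != a -> M04_orbits (linear_structure l S).
Proof.
move=> hu lh Sh a0 d0 da; exists (d / a) => //.
have da0 : d - a != 0 by rewrite subr_eq0.
(* The columns are eigenvectors for [a], [d] and 0; the last is scaled to end in [a^-1], as
   [M04_orbit] requires. *)
pose T : 'M[K]_3 := \matrix_(i, j) nth 0 (nth [::]
  [:: [:: 1; b / (d - a); (b * s2 / d - s1) / a / a];
      [:: 0; 1; - s2 / d / a]; [:: 0; 0; a^-1]] i) j.
have Tu : T \in unitmx.
  apply: upper_unitmx => [i j|i]; rewrite mxE.
    by elim/ord3_ind: i; elim/ord3_ind: j.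
  by elim/ord3_ind: i => /=; rewrite ?oner_eq0 ?invr_eq0.
apply: (@M04_orbit _ _ _ (h *m T) _ a) => //; first by rewrite unitmx_mul hu.
  rewrite mulmxA lh; apply/rowP; elim/ord3_ind; rewrite !mxE sum3 !mxE /=; ring.
rewrite mulmxA Sh -!mulmxA; congr (_ *m _); apply/matrixP => i j.
rewrite !mxE !sum3 !mxE.
by elim/ord3_ind: i; elim/ord3_ind: j => /=; field; rewrite ?a0 ?d0 ?da0.
Qed.

Lemma linear_structure_closure l S : l *m S = 0 ->
  zclosure M04_orbits (linear_structure l S).
Proof.
move=> lS; have ups := upoly_subalg K.
have [->|l0] := eqVneq l 0.
  (* For [t] nonzero [g t] is a multiple of [M04 0], isomorphic to it; at [t = 0] it is the zero
     structure. *)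
  pose g t := linear_structure (t *: delta2 K) (diag3 1 0 0).
  have -> : linear_structure 0 S = g 0.
    by apply/ffunP => p; rewrite !ffunE scale0r !mxE !mul0r.
  apply: (@zclosure_path _ _ _ _ id 1) => [i||//|t t0]; last 2 first.
  - exact: oner_neq0.
  - exists 0 => //; apply: (@M04_orbit _ _ _ (t^-1)%:M _ 1).
    + exact: oner_neq0.
    + by rewrite -scalemx1 unitmxZ ?unitmx1 // unitfE invr_eq0.
    + by rewrite mul_mx_scalar scalerA mulVf // invr1.
    + by rewrite scalar_mxC mulr0.
  - under eq_fun do rewrite ffunE.
    apply: upolyD; apply: upolyM; try exact: upoly_cst;
    under eq_fun do rewrite !mxE; apply: upolyM;
    by [exact: upoly_id|exact: upoly_cst].
  - exact: upoly_id.
have [h hu lh] := row_completion l0.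
have dA : delta2 K *m (invmx h *m S *m h) = 0.
  by rewrite -lh !mulmxA mulmxK // lS mul0mx.
have [h2 h2u [dh2 [a [b [d [s1 [s2 Ah2]]]]]]] := triangularise dA.
pose H := h *m h2; have Hu : H \in unitmx by rewrite unitmx_mul hu.
have lH : l *m H = delta2 K by rewrite mulmxA lh.
have SH : S *m H = H *m triangular3 a b d s1 s2.
  by rewrite -[RHS]mulmxA -Ah2 !mulmxA mulmxV // mul1mx.
(* In the triangularising basis [X] is diag(1, 2, 0), so the eigenvalues a + t and d + 2t are
   nonzero and distinct for general [t]. *)
pose X := H *m diag3 1 2%:R 0 *m invmx H.
pose g t := linear_structure l (S + t *: X).
have -> : linear_structure l S = g 0 by rewrite /g scale0r addr0.
have XH t : (S + t *: X) *m H = H *m triangular3 (a + t * 1) b (d + t * 2%:R) s1 s2.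
  rewrite mulmxDl SH -scalemxAl mulmxKV // scalemxAr -mulmxDr; congr (_ *m _).
  apply/matrixP => i j; rewrite !mxE.
  by elim/ord3_ind: i; elim/ord3_ind: j => /=; ring.
have [s Ds] : exists s, (a + s * 1) * (d + s * 2%:R) * (d - a + s * 1) != 0.
  have nz2 : (2%:R : K) != 0 by rewrite pnatr_eq0.
  (* The points supplied are those where the affine factors take the value 1, so none of the factors
     is identically zero. *)
  have [||u0 Hu0] := @upoly_neq0M _ _ _ (1 - a) ((1 - d) / 2%:R) (upoly_affine a 1)
    (upoly_affine d 2%:R).
  - by rewrite mulr1 addrC subrK oner_neq0.
  - by rewrite divfK // addrC subrK oner_neq0.
  have [|u Hu1] := @upoly_neq0M _ _ _ u0 (1 - (d - a))
    (upolyM (upoly_affine a 1) (upoly_affine d 2%:R)) (upoly_affine (d - a) 1) Hu0.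
    by rewrite mulr1 addrC subrK oner_neq0.
  by exists u.
apply: (@zclosure_path _ _ _ g
  (fun t => (a + t * 1) * (d + t * 2%:R) * (d - a + t * 1)) s) => [i||//|t].
- under eq_fun do rewrite ffunE.
  by apply: upolyD; apply: upolyM; try exact: upoly_cst;
  under eq_fun do rewrite !mxE; apply: upoly_affine.
- by apply: upolyM; [apply: upolyM|]; apply: upoly_affine.
rewrite !mulf_eq0 !negb_or => /andP[/andP[at0 dt0] dat].
apply: triangular_M04_orbits Hu lH (XH t) at0 dt0 _.
by rewrite -subr_eq0; apply: contraNneq dat => <-; apply/eqP; ring.
Qed.

End LinearStructures.

(** * Components and rigidity *)


Section Components.
Variable K : numClosedFieldType.
Implicit Types (c d : structure3 K) (l : 'rV[K]_3) (w : 'cV[K]_3).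
Implicit Types (B S g h : 'M[K]_3).
Local Notation L := (metabelian_commutative K).
Local Notation C1 := (zclosure (GLorbit (@M07 K))).
Local Notation C2 := (zclosure (@M04_orbits K)).
Local Notation triple := ('I_3 * 'I_3 * 'I_3)%type.

(* Up to scaling the action of invmx h, but polynomial in a, h and c. *)
Definition adj_action (a : K) h c : structure3 K :=
  [ffun p => a * \sum_l \adj h p.2 l *
     \sum_u \sum_v c (u, v, l) * h u p.1.1 * h v p.1.2].

(** Scaling [h] by m scales the action of its inverse by m, quadratically from the arguments and
    inversely from the value; m = a det h turns the inverse into [a] times the adjugate. *)
Lemma adj_action_gact a h c : a != 0 -> h \in unitmx ->
  adj_action a h c = gact (invmx ((a * \det h) *: h)) c.
Proof.
move=> a0 hu; have dh : \det h != 0 by rewrite -unitfE -unitmxE.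
have kh0 : a * \det h != 0 by rewrite mulf_neq0.
apply/ffunP => -[[i j] k]; rewrite gactE invmxK ffunE /= mulr_sumr.
apply: eq_bigr => r _.
have adjE : (\adj h) k r = \det h * invmx h k r.
  by rewrite /invmx hu [in RHS]mxE mulrA mulfV // mul1r.
rewrite invmxZ ?unitmxZ ?unitfE // [X in _ = X * _]mxE adjE.
have sumE (m : K) : \sum_u \sum_v c (u, v, r) * (m *: h) u i * (m *: h) v j =
    m ^+ 2 * \sum_u \sum_v c (u, v, r) * h u i * h v j.
  rewrite mulr_sumr; apply: eq_bigr => u _; rewrite mulr_sumr.
  by apply: eq_bigr => v _; rewrite !mxE; ring.
rewrite sumE.
move: (invmx h k r) (\sum_u _) => x y; field; by rewrite a0 dh.
Qed.

Lemma gact_adj_action g c : g \in unitmx ->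
  gact g c = adj_action (\det g) (invmx g) c.
Proof.
move=> gu; have dg : \det g != 0 by rewrite -unitfE -unitmxE.
by rewrite adj_action_gact ?unitmx_inv // det_inv mulfV // scale1r invmxK.
Qed.

(** The parameter, the inverse matrix and the scalar of [adj_action] are interpolated affinely at
    the same time; the curve stays in the orbits where the scalar and the determinant are
    nonzero. *)
Lemma zirreducible_orbits (c : K -> structure3 K) :
  (forall p, upoly (fun s => c s p)) ->
  zirreducible (\bigcup_(s in [set: K]) GLorbit (c s)).
Proof.
move=> cp; apply: zirreducible_path.
  by exists (c 0), 0 => //; apply: GLorbit_refl.
move=> _ _ [s1 _ [g1 g1u ->]] [s2 _ [g2 g2u ->]].
pose a t := \det g1 + t * (\det g2 - \det g1).
pose h t := invmx g1 + t *: (invmx g2 - invmx g1).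
pose s t := s1 + t * (s2 - s1).
have h0 : h 0 = invmx g1 by rewrite /h scale0r addr0.
have h1 : h 1 = invmx g2 by rewrite /h scale1r addrC subrK.
have ups := upoly_subalg K.
have hp i j : upoly (fun t => h t i j).
  by under eq_fun do rewrite 3!mxE; apply: upoly_affine.
have csp p : upoly (fun t => c (s t) p).
  have [P HP] := cp p; exists (P \Po (s1%:P + 'X * (s2 - s1)%:P)) => t.
  by rewrite HP horner_comp !hornerE.
exists (fun t => adj_action (a t) (h t) (c (s t))), (fun t => a t * \det (h t)).
exists 0, 0, 1; split.
- move=> [[i j] k]; under eq_fun do rewrite ffunE /=.
  apply: upolyM; first exact: upoly_affine.
  apply: (subalg_sum ups) => r; apply: upolyM; first exact: (subalg_adj ups).
  apply: (subalg_sum ups) => u; apply: (subalg_sum ups) => v.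
  by apply: upolyM => //; apply: upolyM.
- by apply: upolyM; [exact: upoly_affine|exact: (subalg_det ups)].
- move=> t; rewrite mulf_eq0 negb_or => /andP[at0 ht0].
  exists (s t) => //; have hu : h t \in unitmx by rewrite unitmxE unitfE.
  rewrite adj_action_gact //; exists (invmx ((a t * \det (h t)) *: h t)) => //.
  by rewrite unitmx_inv unitmxZ // unitfE mulf_neq0.
- have dg1 : \det g1 != 0 by rewrite -unitfE -unitmxE.
  split.
  + by rewrite h0 /a mul0r addr0 det_inv mulfV ?oner_neq0.
  + by rewrite h0 /a /s !mul0r !addr0 gact_adj_action.
  + by rewrite h1 /a /s !mul1r ![_ + (_ - _)]addrC !subrK gact_adj_action.
Qed.

Lemma zirreducible_C1 : zirreducible C1.
Proof.
apply: zirreducible_zclosure.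
(* A single orbit is the union over a constant family. *)
have -> : GLorbit (@M07 K) = \bigcup_(s in [set: K]) GLorbit M07.
  by apply/seteqP; split=> [x Mx|x []//]; exists 0.
by apply: zirreducible_orbits => p; apply: upoly_cst.
Qed.

Lemma upoly_M04 p : upoly (fun a : K => M04 a p).
Proof.
case: p => [[i j] k]; under eq_fun do rewrite M04E ffunE !mxE.
have ups := upoly_subalg K.
have dp (u v : 'I_3) : upoly (fun a : K => if u != v then 0 else nth 0 [:: 1; a; 0] u).
  case: (u != v); first exact: upoly_cst.
  by elim/ord3_ind: u => /=; [exact: upoly_cst|exact: upoly_id|exact: upoly_cst].
by apply: upolyD; apply: upolyM => //; apply: upoly_cst.
Qed.

Lemma zirreducible_C2 : zirreducible C2.
Proof.
by apply: zirreducible_zclosure; apply: zirreducible_orbits; apply: upoly_M04.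
Qed.

Lemma metabelian_M07 : L M07.
Proof.
rewrite M07E; apply: metabelian_rank1.
  by apply/matrixP => i j; rewrite !mxE addnC.
by apply/matrixP => i j; rewrite !ord1 [LHS]form_e !mxE.
Qed.

Lemma metabelian_M04 a : L (M04 a).
Proof.
rewrite M04E; apply: metabelian_linear; apply/rowP => j.
by rewrite -rowE !mxE; elim/ord3_ind: j.
Qed.

Lemma C1_sub : C1 `<=` L.
Proof.
apply: zclosure_min; first exact: zclosed_metabelian.
by move=> _ [g gu ->]; apply: metabelian_gact => //; apply: metabelian_M07.
Qed.

Lemma C2_sub : C2 `<=` L.
Proof.
apply: zclosure_min; first exact: zclosed_metabelian.
by move=> _ [a _ [g gu ->]]; apply: metabelian_gact => //; apply: metabelian_M04.
Qed.

Lemma metabelian_cover c : L c -> GLorbit M07 c \/ C2 c.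
Proof.
have nz2 : (2%:R : K) != 0 by rewrite pnatr_eq0.
move=> /(metabelian_rank1_or_linear nz2)[[B [w [BT Bww ->]]]|[l [S [lS ->]]]].
  have [|[l [S [lS ->]]]] := rank1_orbit_or_linear BT Bww; first by left.
  by right; apply: linear_structure_closure.
by right; apply: linear_structure_closure.
Qed.

Lemma polyfun_slice_det (k : 'I_3) :
  polyfun (fun c : structure3 K => \det (\matrix_(i, j) c (i, j, k))).
Proof.
apply: (subalg_det (polyfun_subalg K triple)) => i j.
under eq_fun do rewrite mxE; exact: polyfun_coord.
Qed.

(** On [M04_orbits] a slice is a sum of two matrices of rank at most 1, hence singular of size 3. *)
Lemma C2_slice_det c k : C2 c -> \det (\matrix_(i, j) c (i, j, k)) = 0.
Proof.
apply: (zclosure_polyfun (polyfun_slice_det k)) => _ [a _ [g gu ->]].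
rewrite M04E gact_linear_structure; move: (_ *m _) (_ *m _ *m _) => l S.
pose s := row k S.
have -> : \matrix_(i, j) linear_structure l S (i, j, k) = l^T *m s + s^T *m l.
  by apply/matrixP => i j; rewrite !mxE !big_ord1 ffunE !mxE /=; ring.
apply/eqP; rewrite -[_ == 0]negbK -unitfE -unitmxE -row_full_unit /row_full.
rewrite neq_ltn; apply/orP; left.
apply: leq_ltn_trans (mxrank_add _ _) _; rewrite ltnS.
rewrite (leq_trans (leq_add (mulmx_max_rank _ _) (mulmx_max_rank _ _))) //.
Qed.

(** The slices are the multiples [w k 0 *: B] with [B] invertible; if all were singular, [w] would
    be zero. *)
Lemma M07_not_C2 c : GLorbit M07 c -> ~ C2 c.
Proof.
case=> g gu -> /C2_slice_det => H.
have wk : forall k, (g *m e_ K i0) k 0 = 0.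
  move=> k; have := H k; rewrite M07E gact_rank1_structure.
  set B := _ *m invmx g; set w := g *m _ => HB.
  have Bu : B \in unitmx.
    have Ju : antidiag3 K \in unitmx by case/mulmx1_unit: (antidiag3K K).
    by rewrite !unitmx_mul unitmx_tr unitmx_inv gu Ju.
  move: HB; have -> : \matrix_(i, j) rank1_structure B w (i, j, k) = w k 0 *: B.
    by apply/matrixP => i j; rewrite [LHS]mxE [RHS]mxE ffunE /= mulrC.
  move=> /eqP; rewrite detZ mulf_eq0 expf_eq0 /= => /orP[/eqP//|].
  by move: Bu; rewrite unitmxE unitfE => /negbTE ->.
have : g *m e_ K i0 = 0 by apply/colP => k; rewrite wk mxE.
move/(congr1 (mulmx (invmx g))); rewrite mulKmx // mulmx0 => /matrixP/(_ i0 0).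
by rewrite !mxE => /eqP; rewrite oner_eq0.
Qed.

Lemma C1_not_sub_C2 : ~ C1 `<=` C2.
Proof.
move=> C12; apply: (@M07_not_C2 M07); first exact: GLorbit_refl.
by apply: C12; apply: subset_zclosure; apply: GLorbit_refl.
Qed.

Lemma C2_not_sub_C1 : ~ C2 `<=` C1.
Proof.
move=> C21; have M1 : C1 (M04 1).
  by apply: C21; apply: subset_zclosure; exists 1 => //; apply: GLorbit_refl.
(* A minor of the pair of products e_1 e_3 and e_2 e_3: zero when all products are multiples of one
   vector, and 1 at [M04 1]. *)
pose f c : K := c (i0, i2, i0) * c (i1, i2, i1) - c (i0, i2, i1) * c (i1, i2, i0).
have sub := polyfun_subalg K triple.
have fp : polyfun f.
  by apply: (subalgB sub); apply: (subalgM sub); apply: polyfun_coord.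
have := zclosure_polyfun fp _ M1; rewrite /f M04E !ffunE !mxE /= => H.
have : (1 : K) = 0; last by apply/eqP; rewrite oner_eq0.
rewrite -[RHS]H; first by ring.
move=> _ [g gu ->]; rewrite M07E gact_rank1_structure.
by move: (_ *m _) (g *m _) => B w; rewrite !ffunE /=; ring.
Qed.

Lemma irr_component_metabelian Z : irr_component L Z <-> Z = C1 \/ Z = C2.
Proof.
have LC Z' : Z' `<=` L -> zirreducible Z' -> Z' `<=` C1 \/ Z' `<=` C2.
  move=> Z'L [_]; apply; try exact: zclosed_zclosure.
  move=> x /Z'L/metabelian_cover[Mx|]; last by right.
  by left; apply: subset_zclosure.
split=> [[ZL irrZ maxZ]|].
  case: (LC Z ZL irrZ) => ZC; [left|right]; apply/esym; apply: maxZ => //.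
  - exact: C1_sub.
  - exact: zirreducible_C1.
  - exact: C2_sub.
  - exact: zirreducible_C2.
case=> ->; split.
- exact: C1_sub.
- exact: zirreducible_C1.
- move=> Z' Z'L irrZ' C1Z'; apply/seteqP; split=> //.
  case: (LC Z' Z'L irrZ') => // Z'C2; case: C1_not_sub_C2.
  exact: subset_trans C1Z' Z'C2.
- exact: C2_sub.
- exact: zirreducible_C2.
- move=> Z' Z'L irrZ' C2Z'; apply/seteqP; split=> //.
  case: (LC Z' Z'L irrZ') => // Z'C1; case: C2_not_sub_C1.
  exact: subset_trans C2Z' Z'C1.
Qed.

Lemma rigid_M07 : rigid L M07.
Proof.
split; first exact: metabelian_M07.
exists (~` C2); split; first by rewrite /zopen setCK; apply: zclosed_zclosure.
apply/seteqP; split=> c; last by case=> /metabelian_cover[].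
move=> Mc; split; last exact: M07_not_C2.
by apply: C1_sub; apply: subset_zclosure.
Qed.

(* N is the matrix of multiplication by e_3. In M04 b it has tr N = 1 + b and
tr N^2 = 1 + b^2, and (tr N)^2 : tr N^2 is an isomorphism invariant. *)
Definition M04_invariant (a : K) c : K :=
  let N : 'M[K]_3 := \matrix_(k, i) c (i, i2, k) in
  (1 + a ^+ 2) * \tr N ^+ 2 - (1 + a) ^+ 2 * \tr (N *m N).

(** N = l(e_3) S + (S e_3) l, and since l S = 0 the second term contributes nothing to either
    trace. *)
Lemma M04_invariant_linear a l S : l *m S = 0 ->
  M04_invariant a (linear_structure l S) =
  l 0 i2 ^+ 2 * ((1 + a ^+ 2) * \tr S ^+ 2 - (1 + a) ^+ 2 * \tr (S *m S)).
Proof.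
move=> lS; rewrite /M04_invariant.
have -> : \matrix_(k, i) linear_structure l S (i, i2, k) =
    l 0 i2 *: S + S *m e_ K i2 *m l.
  apply/matrixP => k i; rewrite [LHS]mxE ffunE /= mulmx_e.
  by rewrite !mxE big_ord1 !mxE; ring.
have trN T : l *m T *m S = 0 -> \tr (T *m S *m e_ K i2 *m l) = 0.
  by move=> lT; rewrite mxtrace_mulC !mulmxA lT mul0mx mxtrace0.
have trN1 : \tr (S *m e_ K i2 *m l) = 0.
  by rewrite -[S]mul1mx trN // mulmx1.
have trN2 : \tr (S *m S *m e_ K i2 *m l) = 0 by rewrite trN // lS mul0mx.
have lSe : S *m e_ K i2 *m l *m S = 0 by rewrite -mulmxA lS mulmx0.
have lSel : S *m e_ K i2 *m l *m (S *m e_ K i2 *m l) = 0.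
  by rewrite !mulmxA lSe !mul0mx.
rewrite mxtraceD mxtraceZ trN1 addr0 mulmxDl !mulmxDr -!scalemxAl -!scalemxAr.
rewrite lSe lSel scaler0 !addr0 !mxtraceD !mxtraceZ !mulmxA trN2; ring.
Qed.

Lemma delta2_diag3 a b : delta2 K *m diag3 a b 0 = 0.
Proof. by apply/rowP => j; rewrite -rowE !mxE; elim/ord3_ind: j. Qed.

Lemma M04_invariant_M04 a b : M04_invariant a (M04 b) =
  (1 + a ^+ 2) * (1 + b) ^+ 2 - (1 + a) ^+ 2 * (1 + b ^+ 2).
Proof.
rewrite M04E M04_invariant_linear ?delta2_diag3 // /mxtrace !sum3 !mxE !sum3 !mxE /=.
ring.
Qed.

Lemma M04_invariant_orbit a c : GLorbit (M04 a) c -> M04_invariant a c = 0.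
Proof.
case=> g gu ->; rewrite M04E gact_linear_structure M04_invariant_linear; last first.
  by rewrite !mulmxA mulmxKV // delta2_diag3 mul0mx.
have trJ T : \tr (g *m T *m invmx g) = \tr T by rewrite mxtrace_mulC mulKmx.
have -> : g *m diag3 1 a 0 *m invmx g *m (g *m diag3 1 a 0 *m invmx g) =
    g *m (diag3 1 a 0 *m diag3 1 a 0) *m invmx g by rewrite !mulmxA mulmxKV.
rewrite !trJ /mxtrace !sum3 !mxE !sum3 !mxE /=; ring.
Qed.

Lemma rigid_isomorphic_M07 c : rigid L c -> alg_isomorphic M07 c.
Proof.
case=> Lc [U [oU OU]]; have [|C2c] := metabelian_cover Lc.
  exact: GLorbit_isomorphic.
have Uc : U c by have := GLorbit_refl c; rewrite OU => -[].
(* An open set meeting the closure [C2] meets the union of orbits itself. *)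
exfalso; have [a [d Md Ud]] : exists a, exists2 d, GLorbit (M04 a) d & U d.
  apply: contrapT => H; suff : (~` U) c by apply.
  apply: (zclosure_min oU _ C2c) => d [a _ Md] Ud.
  by apply: H; exists a, d.
have LM04 b : L (M04 b) by exact: metabelian_M04.
have Od : GLorbit c d.
  by rewrite OU; split=> //; case: Md => g gu ->; apply: metabelian_gact.
have Oa : GLorbit c (M04 a) by apply: GLorbit_trans Od (GLorbit_sym Md).
have [p [Up pa]] : exists p, (forall x, (~` U) x -> peval x p = 0) /\ peval (M04 a) p != 0.
  by apply: zclosed_separate => // nU; move: Oa; rewrite OU => -[].
(* The invariant for [a] evaluated at [M04 b]. A [u] with [p] nonzero at [M04 u] and [q u != 0] puts
   [M04 u] in the orbit of [c], hence of [M04 a], although the invariant separates them. *)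
pose q (b : K) := (1 + a ^+ 2) * (1 + b) ^+ 2 - (1 + a) ^+ 2 * (1 + b ^+ 2).
have ups := upoly_subalg K.
have qp : upoly q.
  have cst := @upoly_cst K; have Xp := upoly_id K.
  apply: (subalgB ups); apply: upolyM => //.
    by apply: (subalgX ups); apply: upolyD.
  by apply: upolyD => //; apply: (subalgX ups).
have [b qb] : exists b, q b != 0.
  have nz2 : (2%:R : K) != 0 by rewrite pnatr_eq0.
  have [a0|a0] := eqVneq a 0.
    by exists 1; rewrite /q a0 (_ : _ - _ = 2%:R) //; ring.
  exists 0; rewrite /q (_ : _ - _ = - (2%:R * a)); last by ring.
  by rewrite oppr_eq0 mulf_neq0.
have [u] := upoly_neq0M (upoly_peval p (@upoly_M04)) qp pa qb.
rewrite mulf_eq0 negb_or => /andP[pu]; case/negP.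
have Ou : GLorbit c (M04 u).
  rewrite OU; split=> //; apply: contrapT => nUu.
  by case/negP: pu; rewrite Up.
have := M04_invariant_orbit (GLorbit_trans (GLorbit_sym Oa) Ou).
by rewrite M04_invariant_M04 /q => ->.
Qed.

End Components.

(** * Dimension of the variety *)


Section DimensionOfMetabelian.
Variable K : numClosedFieldType.
Implicit Types (c d : structure3 K) (l : 'rV[K]_3) (w : 'cV[K]_3).
Implicit Types (B S : 'M[K]_3) (x y : {ffun 'I_8 -> K}).
Local Notation L := (metabelian_commutative K).
Local Notation "x `[ k ]" := (x (inord k : 'I_8))
  (at level 2, format "x `[ k ]").

(** Chart l_1 = 1: coordinates 6 and 7 complete [l], and 0 to 5 fill the last two rows of [S]. *)
Definition linear_chart_functional x : 'rV[K]_3 :=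
  \row_j nth 0 [:: 1; x`[6]; x`[7]] j.

(* The first row is forced by l S = 0, as l e_1 = 1. *)
Definition linear_chart_operator x : 'M[K]_3 := \matrix_(i, j)
  nth 0 [:: - (x`[6] * x`[j] + x`[7] * x`[3 + j]); x`[j]; x`[3 + j]] i.

Definition linear_chart x : structure3 K :=
  linear_structure (linear_chart_functional x) (linear_chart_operator x).

(** Chart w_1 = 1: coordinates 0 and 1 complete [w], and 2 to 6 give the form. The source is padded
    to dimension 8 to be common to all charts. *)
Definition rank1_chart_vector x : 'cV[K]_3 := \col_j nth 0 [:: 1; x`[0]; x`[1]] j.

(* The first entry is forced by B(w, w) = 0, as w_1 = 1. *)
Definition rank1_chart_form x : 'M[K]_3 := \matrix_(i, j) nth 0 (nth [::]
  [:: [:: - (2%:R * x`[2] * x`[0] + 2%:R * x`[3] * x`[1] + x`[4] * x`[0] ^+ 2 +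
             2%:R * x`[5] * x`[0] * x`[1] + x`[6] * x`[1] ^+ 2); x`[2]; x`[3]];
      [:: x`[2]; x`[4]; x`[5]]; [:: x`[3]; x`[5]; x`[6]]] i) j.

Definition rank1_chart x : structure3 K :=
  rank1_structure (rank1_chart_form x) (rank1_chart_vector x).

Definition permute (s : 'S_3) c : structure3 K :=
  [ffun p => c (s p.1.1, s p.1.2, s p.2)].

(** The transposition brings to the first place an index at which [l] or [w] is nonzero. *)
Definition chart (u : bool * 'I_3) x : structure3 K :=
  permute (tperm i0 u.2) (if u.1 then linear_chart x else rank1_chart x).

Lemma polyfun_chart u p : polyfun (fun x => chart u x p).
Proof.
have sub := polyfun_subalg K 'I_8.
have crd (i : 'I_8) := @polyfun_coord K _ i.
have cst := subalg_cst sub.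
case: u p => [[] k] [[i j] m]; under eq_fun do rewrite !ffunE !mxE /=.
- have Sp (i' j' : 'I_3) : polyfun (fun x =>
      nth 0 [:: - (x`[6] * x`[j'] + x`[7] * x`[3 + j']); x`[j']; x`[3 + j']] i').
    elim/ord3_ind: i' => //=; apply: (subalgN sub).
    by apply: (subalgD sub); apply: (subalgM sub).
  have lp (j' : 'I_3) : polyfun (fun x => nth 0 [:: 1; x`[6]; x`[7]] j').
    by elim/ord3_ind: j' => /=.
  by apply: (subalgD sub); apply: (subalgM sub).
- apply: (subalgM sub).
    move: (tperm _ _ i) (tperm _ _ j) => i' j'.
    elim/ord3_ind: i'; elim/ord3_ind: j' => //=; apply: (subalgN sub).
    by do ?[exact: crd | exact: cst | apply: (subalgX sub) | apply: (subalgM sub)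
           | apply: (subalgD sub)].
  by elim/ord3_ind: (tperm _ _ m) => /=.
Qed.

(** The pair (l, S) may be replaced by (l / a, a S), which normalizes the first entry of [l]. *)
Lemma linear_chart_surj l S : l *m S = 0 -> l 0 i0 != 0 ->
  exists x, linear_structure l S = linear_chart x.
Proof.
move=> lS l0; pose a := l 0 i0.
pose x : {ffun 'I_8 -> K} := [ffun k : 'I_8 => nth 0 [:: a * S i1 i0; a * S i1 i1;
  a * S i1 i2; a * S i2 i0; a * S i2 i1; a * S i2 i2; l 0 i1 / a; l 0 i2 / a] k].
have S0 j : S i0 j = - (l 0 i1 * S i1 j + l 0 i2 * S i2 j) / a.
  have /rowP/(_ j) := lS; rewrite !mxE sum3 -/a => H.
  apply: (mulfI l0); rewrite -/a [RHS]mulrC divfK //.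
  by apply/eqP; rewrite -subr_eq0 -[X in _ == X]H; apply/eqP; ring.
have a0 : a != 0 by [].
have xE k : (k < 8)%N -> x`[k] = nth 0 [:: a * S i1 i0; a * S i1 i1; a * S i1 i2;
    a * S i2 i0; a * S i2 i1; a * S i2 i2; l 0 i1 / a; l 0 i2 / a] k.
  by move=> k8; rewrite ffunE inordK.
exists x.
have lE j : l 0 j = a * linear_chart_functional x 0 j.
  by rewrite mxE; elim/ord3_ind: j; rewrite /= ?xE //= ?mulr1 // mulrC divfK.
have SE i j : S i j = a^-1 * linear_chart_operator x i j.
  rewrite mxE; elim/ord3_ind: i; elim/ord3_ind: j; rewrite /= ?xE //= ?S0;
  by field.
by apply/ffunP => p; rewrite !ffunE !lE !SE; field.
Qed.

Lemma rank1_chart_surj B w : B^T = B -> w^T *m B *m w = 0 -> w i0 0 != 0 ->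
  exists x, rank1_structure B w = rank1_chart x.
Proof.
move=> BT Bw w0; pose a := w i0 0.
pose s : seq K := [:: w i1 0 / a; w i2 0 / a; a * B i0 i1; a * B i0 i2;
  a * B i1 i1; a * B i1 i2; a * B i2 i2].
pose x : {ffun 'I_8 -> K} := [ffun k : 'I_8 => nth 0 s k].
have a0 : a != 0 by [].
have Bsym i j : B i j = B j i by rewrite -[in LHS]BT mxE.
have B00 : B i0 i0 = - (2%:R * B i0 i1 * w i1 0 / a + 2%:R * B i0 i2 * w i2 0 / a +
  B i1 i1 * (w i1 0 / a) ^+ 2 + 2%:R * B i1 i2 * w i1 0 * w i2 0 / a ^+ 2 +
  B i2 i2 * (w i2 0 / a) ^+ 2).
  have /matrixP/(_ 0 0) := Bw; rewrite [in RHS]mxE mxE sum3 !mxE !sum3 !mxE -/a.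
  rewrite (Bsym i1 i0) (Bsym i2 i0) (Bsym i2 i1) => H.
  apply: (mulfI (mulf_neq0 a0 a0)); apply/eqP; rewrite -subr_eq0 -[X in _ == X]H.
  by apply/eqP; field.
have xE k : (k < 8)%N -> x`[k] = nth 0 s k by move=> k8; rewrite ffunE inordK.
exists x.
have wE j : w j 0 = a * rank1_chart_vector x j 0.
  by rewrite mxE; elim/ord3_ind: j; rewrite /= ?xE //= ?mulr1 // mulrC divfK.
have BE i j : B i j = a^-1 * rank1_chart_form x i j.
  rewrite mxE; elim/ord3_ind: i; elim/ord3_ind: j; rewrite /= ?xE //= ?B00;
  by rewrite ?(Bsym i1 i0) ?(Bsym i2 i0) ?(Bsym i2 i1); field.
by apply/ffunP => p; rewrite !ffunE wE BE; field.
Qed.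

Lemma linear_chart0 : linear_chart 0 = 0.
Proof.
apply/ffunP => -[[i j] k]; rewrite !ffunE !mxE.
by elim/ord3_ind: k; rewrite /= !ffunE; ring.
Qed.

Lemma permute0 s : permute s 0 = 0.
Proof. by apply/ffunP => p; rewrite !ffunE. Qed.

Lemma chart_cover c : L c -> exists u, range (chart u) c.
Proof.
have nz2 : (2%:R : K) != 0 by rewrite pnatr_eq0.
have H0 : exists u, range (chart u) 0.
  by exists (true, i0), 0 => //; rewrite /chart /= linear_chart0 permute0.
move=> /(metabelian_rank1_or_linear nz2)[[B [w [BT Bw ->]]]|[l [S [lS ->]]]].
  have [w0|] := eqVneq w^T 0.
    suff -> : rank1_structure B w = 0 by [].
    apply/ffunP => p; rewrite !ffunE.
    by have /rowP/(_ p.2) := w0; rewrite !mxE => ->; rewrite mulr0.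
  case/rV_neq0P => k; rewrite mxE => wk; pose s := tperm i0 k.
  have [|||x Hx] := @rank1_chart_surj (\matrix_(i, j) B (s i) (s j))
     (\col_i w (s i) 0).
  - by apply/matrixP => i j; rewrite !mxE -[in LHS]BT mxE.
  - apply/matrixP => a b; rewrite !ord1; have /matrixP/(_ 0 0) := Bw; rewrite !mxE => H.
    rewrite -[RHS]H [RHS](reindex_inj (@perm_inj _ s)); apply: eq_bigr => j _.
    rewrite !mxE; congr (_ * _); rewrite [RHS](reindex_inj (@perm_inj _ s)).
    by apply: eq_bigr => i _; rewrite !mxE.
  - by rewrite mxE tpermL.
  exists (false, k), x => //; rewrite /chart /= -Hx -/s.
  by apply/ffunP => -[[i j] m]; rewrite !ffunE !mxE /= !tpermK.
have [->|] := eqVneq l 0.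
  suff -> : linear_structure 0 S = 0 by [].
  by apply/ffunP => p; rewrite !ffunE !mxE !mul0r addr0.
case/rV_neq0P => k lk; pose s := tperm i0 k.
have [||x Hx] := @linear_chart_surj (\row_i l 0 (s i)) (\matrix_(i, j) S (s i) (s j)).
- apply/rowP => j; have /rowP/(_ (s j)) := lS; rewrite !mxE => H.
  rewrite -[RHS]H [RHS](reindex_inj (@perm_inj _ s)).
  by apply: eq_bigr => i _; rewrite !mxE.
- by rewrite mxE tpermL.
exists (true, k), x => //; rewrite /chart /= -Hx -/s.
by apply/ffunP => -[[i j] m]; rewrite !ffunE !mxE /= !tpermK.
Qed.

(** * A chain of eight strict inclusions *)

Lemma metabelian_linear_chart x : L (linear_chart x).
Proof.
apply: metabelian_linear; apply/rowP => j; rewrite !mxE sum3 !mxE /=; ring.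
Qed.

Definition flag (n : nat) : set {ffun 'I_8 -> K} :=
  [set x | forall j : 'I_8, (n <= j)%N -> x j = 0].

(** A structure constant that vanishes on the image of [flag n] but not on that of [flag n.+1]; the
    default of [nth] is the entry for n = 7. *)
Definition flag_coord (n : nat) : 'I_3 * 'I_3 * 'I_3 :=
  nth (i2, i2, i1) [:: (i0, i0, i1); (i0, i1, i1); (i0, i2, i1);
    (i0, i0, i2); (i0, i1, i2); (i0, i2, i2); (i0, i0, i0)] n.

(** A point of [flag n.+1] where that constant is nonzero. For n = 6 and 7 the constants are -2 (x6
    x0 + x7 x3) and 2 x7 x2, so a second coordinate must be set to 1. *)
Definition flag_point (n : nat) : {ffun 'I_8 -> K} :=
  [ffun j : 'I_8 => ((j == n :> nat) || (n == 6) && (j == 0 :> nat)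
     || (n == 7) && (j == 2 :> nat))%:R].

Lemma flag_coord_vanish n x : (n < 8)%N -> flag n x -> linear_chart x (flag_coord n) = 0.
Proof.
move=> n8 Fx; have H k : (n <= k)%N -> (k < 8)%N -> x`[k] = 0.
  by move=> nk k8; apply: Fx; rewrite inordK.
have H7 : x`[7] = 0 by apply: H => //; rewrite -ltnS.
case: n n8 {Fx} H => [|[|[|[|[|[|[|[|//]]]]]]]] _ H; rewrite ffunE !mxE /=;
  rewrite /i0 /= ?addn0 ?H7 ?(H 6) //.
- rewrite (H 0) //; ring.
- rewrite (H 1) //; ring.
- rewrite (H 2) //; ring.
- rewrite (H 3) //; ring.
- rewrite (H 4) //; ring.
- rewrite (H 5) //; ring.
- ring.
- ring.
Qed.

Lemma flag_coord_point n : (n < 8)%N -> linear_chart (flag_point n) (flag_coord n) != 0.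
Proof.
have E k : (k < 8)%N -> (flag_point n)`[k] =
    ((k == n) || (n == 6) && (k == 0) || (n == 7) && (k == 2))%N%:R.
  by move=> k8; rewrite ffunE inordK.
have nz2 : (2%:R : K) != 0 by rewrite pnatr_eq0.
case: n E => [|[|[|[|[|[|[|[|//]]]]]]]] E _; rewrite ffunE !mxE /=;
  rewrite !E //= ?(mul0r, mulr0, mul1r, mulr1, addr0, add0r, oner_eq0) //.
all: by rewrite -?opprD ?oppr_eq0 -mulr2n.
Qed.

Lemma zdim_metabelian : zdim L 8.
Proof.
split; last first.
  move=> n Z chZ; have := @irr_chain_le_dim K _ L 'I_8 _ (enum {: bool * 'I_3})
    chart n Z polyfun_chart _ chZ.
  rewrite card_ord; apply=> c /chart_cover[u uc]; exists u; first by rewrite mem_enum.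
  exact: subset_zclosure.
pose Z n := zclosure (linear_chart @` flag n); exists Z; split=> n n8.
  split; last first.
    apply: zirreducible_zclosure; apply: zirreducible_image.
    - by exists 0 => j _; rewrite ffunE.
    (* [linear_chart] is the chart of index [(true, i0)], whose transposition is the identity. *)
    - move=> p; have := polyfun_chart (true, i0) p; rewrite /chart /= tperm1.
      by under eq_fun do rewrite ffunE /= !perm1 -!surjective_pairing.
    - by move=> x y t Px Py j nj; rewrite ffunE Px // Py // subrr mulr0 addr0.
  exists (Z n); split; first exact: zclosed_zclosure.
  apply/seteqP; split=> [c Zc|c []//]; split=> //.
  apply: zclosure_min Zc; first exact: zclosed_metabelian.
  by move=> _ [x _ <-]; apply: metabelian_linear_chart.
split.
  apply: zclosure_min; first exact: zclosed_zclosure.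
  move=> _ [x Fx <-]; apply: subset_zclosure; exists x => // j nj.
  by apply: Fx; apply: ltnW.
move=> ZZ; have := flag_coord_point n8; case/negP; apply/eqP.
have vanish c : Z n c -> c (flag_coord n) = 0.
  move=> Zc; apply: (zclosure_polyfun (polyfun_coord K (flag_coord n)) _ Zc).
  by move=> _ [x Fx <-]; exact: flag_coord_vanish.
apply: vanish; apply: ZZ; apply: subset_zclosure; exists (flag_point n) => // j nj.
rewrite ffunE (gtn_eqF nj) /=; move: nj n8.
by case: n => [|[|[|[|[|[|[|[|//]]]]]]]] //=;
  case: (val j) => [|[|[|]]].
Qed.

End DimensionOfMetabelian.

Theorem theoremG1 (R : realType) :
  let L := metabelian_commutative R[i] in
  let C1 := zclosure (GLorbit M07) in
  let C2 := zclosure (\bigcup_(alpha in [set: R[i]]) GLorbit (M04 alpha)) in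
  [/\ zdim L 8,
      C1 <> C2,
      (forall Z, irr_component L Z <-> Z = C1 \/ Z = C2) &
      exists A, rigid L A /\ forall B, rigid L B -> alg_isomorphic A B].
Proof.
split.
- exact: zdim_metabelian.
- by move=> C12; apply: (@C1_not_sub_C2 R[i]); rewrite C12.
- exact: irr_component_metabelian.
- by exists M07; split; [exact: rigid_M07|exact: rigid_isomorphic_M07].
Qed.
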